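(* Let $\mathbb{K}$ be a field and let $\zeta_{\mathrm{ParQSym}}:\mathrm{ParQSym}\to\mathbb{K}$ be the linear map with $\zeta_{\mathrm{ParQSym}}(M_\pi)=1$ if $\pi$ is $\otimes$-irreducible (including $\pi=\emptyset$) and $\zeta_{\mathrm{ParQSym}}(M_\pi)=0$ otherwise. Then $(\mathrm{ParQSym},\zeta_{\mathrm{ParQSym}})$ is a Combinatorial Hopf Algebra.
   Context: A Combinatorial Hopf Algebra over $\mathbb{K}$ is a connected graded Hopf algebra $\mathcal{H}$ over $\mathbb{K}$ together with a character $\zeta:\mathcal{H}\to\mathbb{K}$, i.e. a $\mathbb{K}$-algebra map. **Partition diagrams.** A partition diagram of order $k\ge 0$ is a set partition of $\{1,\dots,k,1',\dots,k'\}$ ($1,\dots,k$ are the upper nodes, $1',\dots,k'$ the lower nodes); for $k=0$ the only one is the empty diagram $\emptyset$. For $\pi$ of order $k$ and $\rho$ of order $m$, $\pi\otimes\rho$ is the diagram of order $k+m$ whose blocks are the blocks of $\pi$ and the blocks of $\rho$ with labels shifted by $k$ ($i\mapsto i+k$, $i'\mapsto (i+k)'$). If $k,m\ge1$, $\pi\bullet\rho$ is obtained from $\pi\otimes\rho$ by merging the block containing $k'$ with the block containing $(k+1)'$. The empty diagram is the unit for both operations. A diagram is $\otimes$-irreducible if it is not of the form $\rho\otimes\sigma$ with $\rho,\sigma$ both non-empty (so $\emptyset$ is $\otimes$-irreducible). Every non-empty $\pi$ is uniquely $\pi_1\otimes\cdots\otimes\pi_l$ with all $\pi_i$ non-empty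 and $\otimes$-irreducible. **ParQSym.** $\mathrm{ParQSym}=\bigoplus_{i\ge0}\mathrm{ParQSym}_i$, where $\mathrm{ParQSym}_i$ is the $\mathbb{K}$-vector space with basis $\{M_\pi:\pi\text{ of order }i\}$. Coproduct: $\Delta M_\sigma=\sum_{\pi\otimes\rho=\sigma}M_\pi\otimes M_\rho$, over all ordered pairs of (possibly empty) diagrams with $\pi\otimes\rho=\sigma$. Counit: $\varepsilon(M_\pi)=\delta_{\pi,\emptyset}$. Product: $M_\emptyset$ is the unit; for non-empty $\rho=\rho_1\otimes\cdots\otimes\rho_n$, $\sigma=\sigma_1\otimes\cdots\otimes\sigma_m$ with all $\rho_i,\sigma_j$ non-empty $\otimes$-irreducible, $$M_\rho\star M_\sigma=\sum M_{(\rho'_1\bullet\sigma'_1)\otimes\cdots\otimes(\rho'_k\bullet\sigma'_k)},$$ over all $k\in\mathbb{N}$ and all pairs of sequences of diagrams $(\rho'_1,\dots,\rho'_k)$, $(\sigma'_1,\dots,\sigma'_k)$ that become $(\rho_1,\dots,\rho_n)$, respectively $(\sigma_1,\dots,\sigma_m)$, after deleting all empty diagrams, and such that $\rho'_s\bullet\sigma'_s\ne\emptyset$ for all $1\le s\le k$. *)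

(* Defs.v *)
From HB Require Import structures.
From mathcomp Require Import all_boot all_order all_algebra.

Set Implicit Arguments.
Unset Strict Implicit.
Unset Printing Implicit Defensive.

(* inl i is the upper node i + 1 and inr i the lower node (i + 1)'. *)
Notation nodes k := ('I_k + 'I_k)%type.

Definition diagram (k : nat) := {P : {set {set nodes k}} | partition P [set: nodes k]}.
HB.instance Definition _ k := SubFinite.on (diagram k).

Definition Diagram k (P : {set {set nodes k}}) (partP : partition P [set: nodes k]) :
    diagram k :=
  exist _ P partP.

Definition diag := {k : nat & diagram k}.

Definition dorder (p : diag) : nat := tag p.

Lemma partition_empty : partition set0 [set: nodes 0].
Proof.
suff -> : [set: nodes 0] = set0 by rewrite partition_set0.
by apply/setP => -[[]|[]].
Qed.

Definition empty_diag : diag := Tagged diagram (Diagram partition_empty).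

Lemma dorder0 (p : diag) : (dorder p == 0%N) = (p == empty_diag).
Proof.
apply/eqP/eqP => [|-> //]; case: p => k P; rewrite /dorder /= => k0.
move: P; rewrite k0 => -[P partP]; rewrite /empty_diag; congr existT.
apply: val_inj => /=; apply/eqP; rewrite -partition_set0.
by move: partP; suff -> : [set: nodes 0] = set0 by []; apply/setP => -[[]|[]].
Qed.

Definition lnode k m (x : nodes k) : nodes (k + m) :=
  match x with inl i => inl (lshift m i) | inr i => inr (lshift m i) end.
Definition rnode k m (x : nodes m) : nodes (k + m) :=
  match x with inl i => inl (rshift k i) | inr i => inr (rshift k i) end.

Lemma lnode_inj k m : injective (@lnode k m).
Proof. by move=> [i|i] [j|j] //= [/val_inj->]. Qed.

Lemma rnode_inj k m : injective (@rnode k m).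
Proof. by move=> [i|i] [j|j] //= [/addnI/val_inj->]. Qed.

Definition tensor_blocks k m (P : {set {set nodes k}}) (Q : {set {set nodes m}}) :
    {set {set nodes (k + m)}} :=
  [set @lnode k m @: (B : {set nodes k}) | B in P] :|:
  [set @rnode k m @: (B : {set nodes m}) | B in Q].

Lemma tensor_blocks_partition k m (P : diagram k) (Q : diagram m) :
  partition (tensor_blocks (val P) (val Q)) [set: nodes (k + m)].
Proof.
case: P Q => P partP [Q partQ] /=.
have pl : partition [set @lnode k m @: (B : {set nodes k}) | B in P]
                    (@lnode k m @: setT).
  by rewrite imset_partition //; apply: lnode_inj.
have pr : partition [set @rnode k m @: (B : {set nodes m}) | B in Q]
                    (@rnode k m @: setT).
  by rewrite imset_partition //; apply: rnode_inj.
have dis : [disjoint @rnode k m @: setT & @lnode k m @: setT].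
  rewrite disjoint_subset; apply/subsetP => _ /imsetP[x _ ->].
  rewrite inE; apply/imsetP => -[y _].
  case: x y => i [] j //= [e];
    by have := ltn_ord j; rewrite -e ltnNge leq_addr.
apply/and3P; split.
- rewrite /cover bigcup_setU -!/(cover _).
  rewrite (cover_partition pl) (cover_partition pr) eqEsubset subsetT /=.
  apply/subsetP => x _; rewrite inE.
  case: x => i; case: (split_ordP i) => j ->; apply/orP.
  + by left; exact: (imset_f (@lnode k m) (in_setT (inl j))).
  + by right; exact: (imset_f (@rnode k m) (in_setT (inl j))).
  + by left; exact: (imset_f (@lnode k m) (in_setT (inr j))).
  + by right; exact: (imset_f (@rnode k m) (in_setT (inr j))).
- apply: (trivIsetU (partition_trivIset pl) (partition_trivIset pr)).
  rewrite disjoint_sym.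
  by rewrite (cover_partition pl) (cover_partition pr).
- by rewrite inE (partition0 pl) (partition0 pr).
Qed.

Definition dtensor (p q : diag) : diag :=
  Tagged diagram
    (Diagram (tensor_blocks_partition (tagged p) (tagged q))).

Section Merge.
Variable T : finType.

Definition merge_blocks (P : {set {set T}}) (x y : T) : {set {set T}} :=
  (pblock P x :|: pblock P y) |: (P :\ pblock P x :\ pblock P y).

Lemma merge_blocks_partition (P : {set {set T}}) (x y : T) :
  partition P [set: T] -> partition (merge_blocks P x y) [set: T].
Proof.
move=> partP; rewrite /merge_blocks.
have covP z : z \in cover P by rewrite (cover_partition partP).
have [Bx By] := (pblock_mem (covP x), pblock_mem (covP y)).
have xB : x \in pblock P x by rewrite mem_pblock.
set B := pblock P x in Bx xB *; set C := pblock P y in By *.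
have partD : partition (P :\ B :\ C) (setT :\: B :\: C).
  have [<-|nBC] := eqVneq B C.
    by rewrite !setDDl !setUid; apply: partitionD1.
  by apply: partitionD1; [apply: partitionD1|rewrite !inE eq_sym nBC].
have -> : [set: T] = (B :|: C) :|: (setT :\: B :\: C).
  by apply/setP => z; rewrite !inE; case: (z \in B); case: (z \in C).
apply: partitionU1 => //; first by apply/set0Pn; exists x; rewrite inE xB.
rewrite disjoint_subset; apply/subsetP => z; rewrite !inE.
by case: (z \in B); case: (z \in C).
Qed.

End Merge.

Definition bullet_diagram k m (P : diagram k.+1) (Q : diagram m.+1) :
    diagram (k.+1 + m.+1) :=
  Diagram (merge_blocks_partition
    (lnode m.+1 (inr ord_max)) (rnode k.+1 (inr ord0))
    (tensor_blocks_partition P Q)).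

Definition dbullet (p q : diag) : diag :=
  match p, q with
  | existT k.+1 P, existT m.+1 Q => Tagged diagram (bullet_diagram P Q)
  | existT 0 _, _ => q
  | _, existT 0 _ => p
  end.

Definition irreducible (p : diag) : Prop :=
  ~ exists r s, [/\ r != empty_diag, s != empty_diag & p = dtensor r s].

Definition dtensor_seq (s : seq diag) : diag := foldr dtensor empty_diag s.

Definition is_factorization (p : diag) (s : seq diag) : Prop :=
  p = dtensor_seq s /\ {in s, forall r, r != empty_diag /\ irreducible r}.

From mathcomp Require Import finmap boolp classical_sets cardinality fsbigop monalg.

Import GRing.Theory.
Local Open Scope ring_scope.
Local Open Scope quotient_scope.

Notation bilinear f := (bilinear_for *:%R *:%R f).

(* The tensor product of two vector spaces is the quotient of the formal sums
   of pairs that identifies two sums when every bilinear map takes the same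
   value on them; [tensor_universal] is its universal property. *)
Section TensorProduct.
Variables (K : fieldType) (U V : lmodType K).

Definition fsum (W : lmodType K) (f : U -> V -> W) (s : seq (U * V)) : W :=
  \sum_(p <- s) f p.1 p.2.

Definition tensor_eq (s t : seq (U * V)) : bool :=
  `[< forall (W : lmodType K) (f : U -> V -> W),
        bilinear f -> fsum f s = fsum f t >].

Lemma tensor_eq_refl : reflexive tensor_eq.
Proof. by move=> s; apply/asboolP. Qed.

Lemma tensor_eq_sym : symmetric tensor_eq.
Proof.
by move=> s t; apply/asboolP/asboolP => st W f fb; rewrite st.
Qed.

Lemma tensor_eq_trans : transitive tensor_eq.
Proof.
move=> t s u /asboolP st /asboolP tu; apply/asboolP => W f fb.
by rewrite st // tu.
Qed.

Canonical tensor_equiv :=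
  EquivRel tensor_eq tensor_eq_refl tensor_eq_sym tensor_eq_trans.

Definition tensor := {eq_quot tensor_equiv}.
HB.instance Definition _ := Choice.on tensor.
HB.instance Definition _ := EqQuotient.on tensor.

Lemma eq_tensorP (s t : seq (U * V)) :
  (forall (W : lmodType K) (f : U -> V -> W),
     bilinear f -> fsum f s = fsum f t) <-> \pi_tensor s = \pi_tensor t.
Proof.
split=> [st|]; first by apply/eqquotP; apply/asboolP.
by move/eqquotP/asboolP.
Qed.

Definition tadd (x y : tensor) : tensor := \pi_tensor (repr x ++ repr y).
Definition tscale (a : K) (x : tensor) : tensor :=
  \pi_tensor [seq (a *: p.1, p.2) | p <- repr x].
Definition topp (x : tensor) : tensor := tscale (- 1) x.
Definition tzero : tensor := \pi_tensor [::].

Lemma fsum_cat (W : lmodType K) (f : U -> V -> W) s t :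
  fsum f (s ++ t) = fsum f s + fsum f t.
Proof. exact: big_cat. Qed.

Lemma fsum_scale (W : lmodType K) (f : U -> V -> W) a s : bilinear f ->
  fsum f [seq (a *: p.1, p.2) | p <- s] = a *: fsum f s.
Proof.
move=> fb; rewrite /fsum big_map scaler_sumr; apply: eq_bigr => p _ /=.
exact: (scalable_linear (fb.1 p.2)).
Qed.

Lemma fsum_repr (W : lmodType K) (f : U -> V -> W) s : bilinear f ->
  fsum f (repr (\pi_tensor s)) = fsum f s.
Proof. by move=> fb; apply/(eq_tensorP _ _).2 => //; rewrite reprK. Qed.

Definition fsumE := (fsum_repr, fsum_cat, fsum_scale).

Lemma tensor_ext (x y : tensor) :
  (forall (W : lmodType K) (f : U -> V -> W),
     bilinear f -> fsum f (repr x) = fsum f (repr y)) -> x = y.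
Proof. by move/(eq_tensorP _ _).1; rewrite !reprK. Qed.

Lemma taddA : associative tadd.
Proof. by move=> x y z; apply: tensor_ext => W f fb; rewrite !fsumE // addrA. Qed.

Lemma taddC : commutative tadd.
Proof. by move=> x y; apply: tensor_ext => W f fb; rewrite !fsumE // addrC. Qed.

Lemma tadd0 : left_id tzero tadd.
Proof.
move=> x; apply: tensor_ext => W f fb.
by rewrite !fsumE // /fsum big_nil add0r.
Qed.

Lemma taddN : left_inverse tzero topp tadd.
Proof.
move=> x; apply: tensor_ext => W f fb.
by rewrite !fsumE // scaleN1r addNr /fsum big_nil.
Qed.

HB.instance Definition _ :=
  GRing.isZmodule.Build tensor taddA taddC tadd0 taddN.

Lemma tscaleA a b x : tscale a (tscale b x) = tscale (a * b) x.
Proof. by apply: tensor_ext => W f fb; rewrite !fsumE // scalerA. Qed.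

Lemma tscale1 : left_id 1 tscale.
Proof. by move=> x; apply: tensor_ext => W f fb; rewrite !fsumE // scale1r. Qed.

Lemma tscaleDr : right_distributive tscale +%R.
Proof.
by move=> a x y; apply: tensor_ext => W f fb; rewrite !fsumE // scalerDr.
Qed.

Lemma tscaleDl x : {morph tscale^~ x : a b / a + b}.
Proof.
by move=> a b; apply: tensor_ext => W f fb; rewrite !fsumE // scalerDl.
Qed.

HB.instance Definition _ :=
  GRing.Zmodule_isLmodule.Build K tensor tscaleA tscale1 tscaleDr tscaleDl.

Definition tpure (u : U) (v : V) : tensor := \pi_tensor [:: (u, v)].

(* Junk value when f is not bilinear. *)
Definition tlift (W : lmodType K) (f : U -> V -> W) (x : tensor) : W :=
  fsum f (repr x).

Lemma tliftE (W : lmodType K) (f : U -> V -> W) u v :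
  bilinear f -> tlift f (tpure u v) = f u v.
Proof. by move=> fb; rewrite /tlift fsum_repr // /fsum big_seq1. Qed.

Lemma tlift_linear (W : lmodType K) (f : U -> V -> W) :
  bilinear f -> linear (tlift f).
Proof. by move=> fb a x y; rewrite /tlift !fsumE. Qed.

Lemma fsum_pure s : fsum tpure s = \pi_tensor s.
Proof.
elim: s => [|[u v] s IHs]; first by rewrite /fsum big_nil.
rewrite /fsum big_cons -/(fsum _ s) IHs /=.
by apply: tensor_ext => W f fb; rewrite !fsumE // -fsum_cat.
Qed.

Lemma tpure_bilinear : bilinear tpure.
Proof.
split=> [v a u u'|u a v v'] /=; apply: tensor_ext => W f fb;
  rewrite !fsumE // /fsum !big_seq1 /=; [exact: fb.1|exact: fb.2].
Qed.

Lemma tensor_span (x : tensor) : exists s, x = fsum tpure s.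
Proof. by exists (repr x); rewrite fsum_pure reprK. Qed.

Lemma tensor_universal (W : lmodType K) (f : U -> V -> W) : bilinear f ->
  exists! g : tensor -> W, linear g /\ forall u v, g (tpure u v) = f u v.
Proof.
move=> fb; exists (tlift f); split.
  by split=> [|u v]; [exact: tlift_linear|exact: tliftE].
move=> g [glin gE]; apply/funext => x.
pose G : {linear tensor -> W} := HB.pack g (GRing.isLinear.Build _ _ _ _ g glin).
rewrite -[x in RHS]reprK -fsum_pure -[g]/(G : _ -> _) /tlift /fsum linear_sum.
by apply: eq_bigr => p _; rewrite /= gE.
Qed.

End TensorProduct.

Arguments tpure {K U V}.
Notation "U \ox V" := (tensor U%type V%type) (at level 40, left associativity) : type_scope.
Notation "u \ox v" := (tpure u v) (at level 40, left associativity) : ring_scope.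

Section TensorMaps.
Variable K : fieldType.
Implicit Types U V W : lmodType K.

Definition tmap U V U' V' (f : U -> U') (g : V -> V') : U \ox V -> U' \ox V' :=
  tlift (fun u v => f u \ox g v).

Definition tassoc U V W : (U \ox V) \ox W -> U \ox (V \ox W) :=
  tlift (fun x w => tlift (fun u v => u \ox (v \ox w)) x).

(* (a \ox b) (c \ox d) = (a c) \ox (b d) *)
Definition tmul U (mul : U -> U -> U) (s t : U \ox U) : U \ox U :=
  tlift (fun a b => tlift (fun c d => mul a c \ox mul b d) t) s.

End TensorMaps.

Section HopfAlgebra.
Variables (K : fieldType) (H : lmodType K).
Implicit Types (one : H) (mul : H -> H -> H) (Delta : H -> H \ox H).
Implicit Types (eps zeta : H -> K) (S : H -> H) (G : nat -> H -> Prop).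

Record is_algebra one mul : Prop := {
  alg_bilinear : bilinear mul;
  alg_assoc : associative mul;
  alg_unitl : left_id one mul;
  alg_unitr : right_id one mul }.

Record is_coalgebra Delta eps : Prop := {
  coalg_linear : linear Delta;
  coalg_counit_linear : scalar eps;
  coalg_coassoc : forall x,
    tassoc (tmap Delta id (Delta x)) = tmap id Delta (Delta x);
  coalg_counitl : forall x, tlift (fun a b => eps a *: b) (Delta x) = x;
  coalg_counitr : forall x, tlift (fun a b => eps b *: a) (Delta x) = x }.

Record is_bialgebra one mul Delta eps : Prop := {
  bialg_algebra : is_algebra one mul;
  bialg_coalgebra : is_coalgebra Delta eps;
  bialg_DeltaM : forall x y, Delta (mul x y) = tmul mul (Delta x) (Delta y);
  bialg_Delta1 : Delta one = one \ox one;
  bialg_epsM : forall x y, eps (mul x y) = eps x * eps y;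
  bialg_eps1 : eps one = 1 }.

Record is_antipode one mul Delta eps S : Prop := {
  antipode_linear : linear S;
  antipodel : forall x,
    tlift (fun a b => mul (S a) b) (Delta x) = eps x *: one;
  antipoder : forall x,
    tlift (fun a b => mul a (S b)) (Delta x) = eps x *: one }.

Definition is_subspace (P : H -> Prop) : Prop :=
  P 0 /\ forall a x y, P x -> P y -> P (a *: x + y).

(* H is the internal direct sum of the subspaces G 0, G 1, ... *)
Record is_direct_sum G : Prop := {
  dsum_subspace : forall n, is_subspace (G n);
  dsum_span : forall x, exists N (f : nat -> H),
    (forall n, G n (f n)) /\ x = \sum_(n < N) f n;
  dsum_direct : forall N (f : nat -> H),
    (forall n, G n (f n)) -> \sum_(n < N) f n = 0 ->
    forall n, (n < N)%N -> f n = 0 }.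

(* The component of degree n of H \ox H: the span of the G i \ox G j with
   i + j = n. *)
Definition tensor_deg G n (x : H \ox H) : Prop :=
  exists s : seq (H * H), x = \sum_(p <- s) p.1 \ox p.2 /\
    forall p, p \in s -> exists i j, [/\ (i + j = n)%N, G i p.1 & G j p.2].

Record is_graded_hopf_algebra G one mul Delta eps : Prop := {
  hopf_bialgebra : is_bialgebra one mul Delta eps;
  hopf_direct_sum : is_direct_sum G;
  hopf_one_deg : G 0%N one;
  hopf_mul_deg : forall i j x y, G i x -> G j y -> G (i + j)%N (mul x y);
  hopf_Delta_deg : forall n x, G n x -> tensor_deg G n (Delta x);
  hopf_eps_deg : forall n x, (0 < n)%N -> G n x -> eps x = 0;
  hopf_antipode : exists S, is_antipode one mul Delta eps S /\
    forall n x, G n x -> G n (S x) }.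

(* The component of degree 0 is a line. *)
Definition is_connected G : Prop :=
  exists2 e, e != 0 & forall x, G 0%N x <-> exists a, x = a *: e.

Record is_character one mul zeta : Prop := {
  char_linear : scalar zeta;
  char_mul : forall x y, zeta (mul x y) = zeta x * zeta y;
  char_one : zeta one = 1 }.

Record is_combinatorial_hopf_algebra G one mul Delta eps zeta : Prop := {
  cha_hopf : is_graded_hopf_algebra G one mul Delta eps;
  cha_connected : is_connected G;
  cha_character : is_character one mul zeta }.

End HopfAlgebra.

Definition splittings (p : diag) : set (diag * diag) :=
  [set rs | dtensor rs.1 rs.2 = p]%classic.

(* The pairs of sequences of the same length k, as sequences of pairs.  When p
   or q is empty the only element pads the factors of the other one with empty
   diagrams, so that the empty diagram is the unit for [ParQSym_mul]. *)
Definition quasi_shuffles (p q : diag) : set (seq (diag * diag)) :=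
  [set t | [/\ is_factorization p [seq r <- unzip1 t | r != empty_diag],
               is_factorization q [seq s <- unzip2 t | s != empty_diag] &
               {in t, forall rs, dbullet rs.1 rs.2 != empty_diag}]]%classic.

(* Since \sum_(i \in A) is 0 by convention when infinitely many terms are
   nonzero, we check that [splittings] and [quasi_shuffles] are finite. *)
Lemma dtensor_seq_order (s : seq diag) :
  dorder (dtensor_seq s) = (\sum_(r <- s) dorder r)%N.
Proof.
elim: s => [|r s IHs]; first by rewrite big_nil.
by rewrite big_cons -IHs.
Qed.

Lemma finite_dorder n : finite_set [set p : diag | (dorder p <= n)%N]%classic.
Proof.
pose f (x : {k : 'I_n.+1 & diagram k}) : diag := Tagged diagram (tagged x).
apply: (@sub_finite_set _ _ (f @` setT)%classic); last by apply: finite_image; apply: finite_finset.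
move=> [k P] /=; rewrite -ltnS => ltkn.
by exists (Tagged (fun k : 'I_n.+1 => diagram k) (P : diagram (Ordinal ltkn))).
Qed.

Lemma finite_splittings p : finite_set (splittings p).
Proof.
apply: (@sub_finite_set _ _ ([set r | (dorder r <= dorder p)%N] `*`
                            [set r | (dorder r <= dorder p)%N])%classic).
  by move=> [r s] /= <-; rewrite /dorder /= leq_addr leq_addl.
by apply: finite_setX; apply: finite_dorder.
Qed.

Lemma finite_seq (T : choiceType) (A : set T) n : finite_set A ->
  finite_set [set s : seq T | (size s <= n)%N /\ {in s, forall x, A x}]%classic.
Proof.
move=> finA; elim: n => [|n IHn].
  apply: (@sub_finite_set _ _ [set [::]]%classic) => // s [].
  by rewrite leqn0 size_eq0 => /eqP.
apply: (@sub_finite_set _ _ ([set [::]] `|`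
   (fun xs => xs.1 :: xs.2) @` (A `*`
     [set s : seq T | (size s <= n)%N /\ {in s, forall x, A x}]))%classic).
  case=> [|x s] [/= le_s sA]; [by left|right].
  exists (x, s) => //; split=> /=; first by apply: sA; rewrite inE eqxx.
  by split=> // y ys; apply: sA; rewrite inE ys orbT.
rewrite finite_setU; split=> //.
by apply: finite_image; apply: finite_setX.
Qed.

Lemma factorization_bounds p s r : is_factorization p [seq x <- s | x != empty_diag] ->
  r \in s -> (dorder r <= dorder p)%N.
Proof.
move=> [-> _] rs; rewrite dtensor_seq_order.
have [->//|nr] := eqVneq r empty_diag.
by rewrite (big_rem r) ?leq_addr // mem_filter nr.
Qed.

Lemma factorization_size p s : is_factorization p s -> (size s <= dorder p)%N.
Proof.
move=> [-> ne]; rewrite dtensor_seq_order -sum1_size big_seq [leqRHS]big_seq.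
by apply: leq_sum => r /ne[+ _]; rewrite -dorder0 -lt0n.
Qed.

Lemma finite_quasi_shuffles p q : finite_set (quasi_shuffles p q).
Proof.
pose A := ([set r | (dorder r <= dorder p)%N] `*`
           [set r | (dorder r <= dorder q)%N])%classic.
apply: (sub_finite_set _ (@finite_seq _ A (dorder p + dorder q) _)); last first.
  by apply: finite_setX; apply: finite_dorder.
move=> t [fp fq ne]; split; last first.
  move=> [r s] rst; split=> /=.
    by apply: (factorization_bounds fp); apply: (map_f fst rst).
  by apply: (factorization_bounds fq); apply: (map_f snd rst).
apply: leq_trans (leq_add (factorization_size fp) (factorization_size fq)).
rewrite !size_filter !count_map -count_predUI.
apply: leq_trans (leq_addr _ _).
rewrite (_ : size t = count xpredT t) ?count_predT // -[leqLHS]count_predT.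
rewrite (eq_in_count (a2 := predU (preim fst (predC1 empty_diag)) (preim snd (predC1 empty_diag)))) //.
move=> [r s] /ne /=; have [->|//] := eqVneq r empty_diag.
by case: (s =P empty_diag) => [es|_ _]; rewrite ?orbT // es eqxx.
Qed.

Section ParQSym.
Variable K : fieldType.

Definition ParQSym : lmodType K := {malg K[diag]}.

Definition M (p : diag) : ParQSym := << p >>.

Definition lin_ext (V : lmodType K) (f : diag -> V) (x : ParQSym) : V :=
  \sum_(p <- msupp x) x@_p *: f p.

Definition ParQSym_deg (n : nat) (x : ParQSym) : Prop :=
  forall p, p \in msupp x -> dorder p = n.

Definition ParQSym_mul (x y : ParQSym) : ParQSym :=
  lin_ext (fun p => lin_ext (fun q =>
    \sum_(t \in quasi_shuffles p q)
      M (dtensor_seq [seq dbullet rs.1 rs.2 | rs <- t])) y) x.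

Definition ParQSym_Delta : ParQSym -> ParQSym \ox ParQSym :=
  lin_ext (fun p => \sum_(rs \in splittings p) (M rs.1 \ox M rs.2)).

Definition ParQSym_eps : ParQSym -> K :=
  lin_ext (V := K^o) (fun p => (p == empty_diag)%:R).

Definition ParQSym_zeta : ParQSym -> K :=
  lin_ext (V := K^o) (fun p => `[< irreducible p >]%:R).

End ParQSym.

(* Main.v *)
From HB Require Import structures.
From mathcomp Require Import all_boot all_order all_algebra zify.
From mathcomp Require Import boolp.
(* Last, so that [bilinear] is the notation of [Defs] and not that of MathComp. *)
Require Import Defs.

(** A diagram factors at a vertical line exactly when no block crosses that line. This gives unique
    factorization, as the first letter ends at the first such line (or at the end of the diagram),
    and it explains why merging preserves letters: the merged block crosses the only line at which
    the tensor product of two letters can be cut. The defining formulas sum over sets of pairs or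
    sequences described by properties, which offer no induction. They are first rewritten as sums
    over recursively built lists without repetitions. In these lists the first pair of a
    quasi-shuffle is of one of three kinds, and this is the origin of the three terms in the
    recursion for B_a. *)

(* Diagrams under tensor form a free monoid on the nonempty irreducible diagrams
   ("letters"), and the merge operation is an associative product on letters.  In the
   basis indexed by words, ParQSym is therefore a quasi-shuffle algebra with
   deconcatenation.  If B_a prepends the letter a to a word, then
     B_a x * B_b y = B_a (x * B_b y) + B_b (B_a x * y) + B_{a bullet b} (x * y),
     Delta (B_a x) = 1 (x) B_a x + (B_a (x) id) (Delta x),
   and associativity and the compatibility of product and coproduct follow by induction
   on the total length of the words.  The antipode is the convolution inverse of the
   identity, computed by recursion on words.  The character satisfies
   zeta (B_a x) = eps x, so the product formula and the multiplicativity of eps give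
   that of zeta. *)

Set Implicit Arguments.
Unset Strict Implicit.
Unset Printing Implicit Defensive.

Import GRing.Theory.

(** * Diagrams as relations *)

(* [(false, i)] is the upper node i + 1 and [(true, i)] the lower node (i + 1)'. *)
Notation node := (bool * nat)%type.

Arguments dorder : simpl never.
Arguments dtensor : simpl never.
Arguments dbullet : simpl never.

Definition nidx k (i : nodes k) : node :=
  match i with inl i => (false, i : nat) | inr i => (true, i : nat) end.

Definition nshift k (x : node) : node := (x.1, k + x.2).

Lemma nidx_lt k (i : nodes k) : (nidx i).2 < k.
Proof. by case: i => i /=. Qed.

Lemma nidx_inj k : injective (@nidx k).
Proof. by case=> i [] j //= [] /val_inj->. Qed.

Lemma nidx_lnode k m (i : nodes k) : nidx (@lnode k m i) = nidx i.
Proof. by case: i. Qed.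

Lemma nidx_rnode k m (i : nodes m) : nidx (@rnode k m i) = nshift k (nidx i).
Proof. by case: i. Qed.

Lemma nidx_surj k (x : node) : x.2 < k -> exists i : nodes k, nidx i = x.
Proof.
by case: x => -[] n /= ltnk; [exists (inr (Ordinal ltnk))|exists (inl (Ordinal ltnk))].
Qed.

(* Relations on all of [node] avoid the casts between the types [nodes k]. *)
Definition drel (p : diag) : rel node := fun x y =>
  [exists B in val (tagged p),
     (x \in [seq nidx i | i in B]) && (y \in [seq nidx i | i in B])].

Lemma drelP (p : diag) (x y : node) :
  reflect (exists B i j, [/\ B \in val (tagged p), i \in B, j \in B, nidx i = x &
                              nidx j = y])
          (drel p x y).
Proof.
apply: (iffP idP) => [/'exists_and3P[B [BP /imageP[i iB ->] /imageP[j jB ->]]]|].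
  by exists B, i, j.
move=> [B [i [j [BP iB jB <- <-]]]]; apply/'exists_and3P; exists B.
by rewrite BP !image_f.
Qed.

Lemma drel_sym p x y : drel p x y = drel p y x.
Proof. by apply: eq_existsb => B; congr (_ && _); rewrite andbC. Qed.

Lemma drel_trans p x y z : drel p x y -> drel p y z -> drel p x z.
Proof.
case/drelP=> B [i [j [BP iB jB <- <-]]] /drelP[C [j' [l [CP jC lC /nidx_inj ej <-]]]].
subst j'.
have tI := partition_trivIset (valP (tagged p)).
have eBC : B = C by rewrite -(def_pblock tI BP jB) (def_pblock tI CP jC).
by apply/drelP; exists B, i, l; split=> //; rewrite eBC.
Qed.

Lemma drel_lt p x y : drel p x y -> (x.2 < dorder p) && (y.2 < dorder p).
Proof. by case/drelP=> B [i [j [_ _ _ <- <-]]]; rewrite !nidx_lt. Qed.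

(** Together with symmetry and transitivity this makes [drel p] a partial equivalence whose domain
    is the set of nodes of [p]. *)
Lemma drel_refl p x : drel p x x = (x.2 < dorder p).
Proof.
apply/idP/idP => [/drel_lt/andP[]//|/nidx_surj[i <-]].
have icov : i \in cover (val (tagged p)).
  by rewrite (cover_partition (valP (tagged p))) in_setT.
apply/drelP; exists (pblock (val (tagged p)) i), i, i.
by split=> //; rewrite ?pblock_mem ?mem_pblock.
Qed.

Lemma drel_pblock (p : diag) (i j : nodes (tag p)) :
  drel p (nidx i) (nidx j) = (j \in pblock (val (tagged p)) i).
Proof.
have tI := partition_trivIset (valP (tagged p)).
apply/drelP/idP => [[B [i' [j' [BP iB jB /nidx_inj ei /nidx_inj ej]]]]|ji].
  by subst i' j'; rewrite (def_pblock tI BP iB).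
have icov : i \in cover (val (tagged p)).
  by rewrite (cover_partition (valP (tagged p))) in_setT.
exists (pblock (val (tagged p)) i), i, j.
by split=> //; rewrite ?pblock_mem ?mem_pblock.
Qed.

(** A partition is the set of classes of its equivalence relation, so it can be rebuilt from [drel].
    The equality of orders removes the dependency on the type of nodes. *)
Lemma diag_eqP p q : dorder p = dorder q -> drel p =2 drel q -> p = q.
Proof.
case: p q => k P [m Q]; rewrite /dorder /= => ekm; subst m => ePQ.
congr existT; apply: val_inj => /=.
rewrite -(equivalence_partition_pblock (valP P)).
rewrite -(equivalence_partition_pblock (valP Q)).
apply: eq_imset => i; apply/setP => j; rewrite !inE /=.
by have := ePQ (nidx i) (nidx j); rewrite !drel_pblock.
Qed.

Lemma drel_tensor p q x y :
  drel (dtensor p q) x y =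
  drel p x y || [&& dorder p <= x.2, dorder p <= y.2 &
    drel q (x.1, x.2 - dorder p) (y.1, y.2 - dorder p)].
Proof.
apply/drelP/orP => [[B [i [j [/setUP[]/imsetP[C CP ->]]]]]|].
- move=> /imsetP[i' iC ->] /imsetP[j' jC ->]; rewrite !nidx_lnode => <- <-.
  by left; apply/drelP; exists C, i', j'.
- move=> /imsetP[i' iC ->] /imsetP[j' jC ->]; rewrite !nidx_rnode => <- <- /=.
  right; rewrite /dorder !leq_addr !addKn /=; apply/drelP; exists C, i', j'.
  by split=> //; case: (nidx _).
case=> [/drelP[B [i [j [BP iB jB <- <-]]]]|].
  exists (@lnode _ (dorder q) @: B), (lnode _ i), (lnode _ j).
  by rewrite !nidx_lnode inE !(imset_f (lnode _)) // (imset_f (fun B : {set _} => _ @: B)).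
case/and3P=> le_x le_y /drelP[B [i [j [BP iB jB ei ej]]]].
exists (@rnode (dorder p) _ @: B), (@rnode _ _ i), (@rnode _ _ j).
rewrite !nidx_rnode inE !(imset_f (@rnode _ _)) //.
rewrite (imset_f (fun B : {set _} => @rnode (tag p) _ @: B)) // orbT; split=> //.
  by rewrite /nshift ei /= subnKC //; case: (x).
by rewrite /nshift ej /= subnKC //; case: (y).
Qed.

Definition rel_merge (T : Type) (R : rel T) (a b : T) : rel T := fun x y =>
  R x y || (R a x || R b x) && (R a y || R b y).

Lemma drel_merge k (P : {set {set nodes k}}) (partP : partition P [set: nodes k]) a b :
  drel (Tagged diagram (Diagram (merge_blocks_partition a b partP))) =2
  rel_merge (drel (Tagged diagram (Diagram partP))) (nidx a) (nidx b).
Proof.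
set p := Tagged _ (Diagram partP).
move=> x y; rewrite /rel_merge; apply/drelP/idP.
  move=> [B [i [j [/setU1P[->|BP] iB jB <- <-]]]].
    by rewrite !drel_pblock -!in_setU iB jB orbT.
  move: BP; rewrite !inE => /and3P[_ _ BP].
  by apply/orP; left; apply/drelP; exists B, i, j.
pose U := pblock P a :|: pblock P b.
have inU z : drel p (nidx a) z || drel p (nidx b) z ->
    exists2 i, i \in U & nidx i = z.
  move=> h; have /nidx_surj[i ei]: z.2 < k by case/orP: h => /drel_lt/andP[].
  by exists i => //; move: h; rewrite -ei !drel_pblock -in_setU.
have Uin i : i \in U -> drel p (nidx a) (nidx i) || drel p (nidx b) (nidx i).
  by rewrite in_setU !drel_pblock.
suff H : (drel p (nidx a) x || drel p (nidx b) x) &&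
    (drel p (nidx a) y || drel p (nidx b) y) ->
    exists (B : {set nodes k}) i j,
      [/\ B \in merge_blocks P a b, i \in B, j \in B, nidx i = x & nidx j = y].
  case/orP=> // /[dup] rxy /drelP[B [i [j [BP iB jB ei ej]]]].
  (* The common block of [x] and [y] survives unless it is one of the two merged blocks; in that
     case both nodes lie in the union and [H] applies. *)
  case: (boolP (drel p (nidx a) x || drel p (nidx b) x)) => [ax|].
    apply: H; rewrite ax; case/orP: ax => ax; apply/orP; [left|right];
      exact: drel_trans ax rxy.
  rewrite -ei !drel_pblock negb_or => /andP[na nb].
  exists B, i, j; split=> //; rewrite !inE.
  apply/orP; right; rewrite BP andbT; apply/andP.
  by split; apply/eqP => eB; [move: nb | move: na]; rewrite /= -eB iB.
move=> /andP[/inU[i iU ei] /inU[j jU ej]].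
by exists U, i, j; split=> //; rewrite in_setU1 eqxx.
Qed.
Lemma dorder_tensor p q : dorder (dtensor p q) = dorder p + dorder q.
Proof. by []. Qed.

Lemma dorder_bullet p q : dorder (dbullet p q) = dorder p + dorder q.
Proof. by case: p q => -[|k] P [[|m] Q]; rewrite /dorder //= addn0. Qed.

(** Indices start at 0: for [p] of order k, the merged nodes k' and (k+1)' are the lower nodes of
    index [(dorder p).-1] and [dorder p]. *)
Lemma drel_bullet p q : 0 < dorder p -> 0 < dorder q ->
  drel (dbullet p q) =2
  rel_merge (drel (dtensor p q)) (true, (dorder p).-1) (true, dorder p).
Proof.
case: p q => -[|k] P // [[|m] Q] // _ _ x y.
rewrite drel_merge nidx_lnode nidx_rnode /nshift /= addn0.
by congr rel_merge.
Qed.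

Lemma empty_bullet p : dbullet empty_diag p = p.
Proof. by []. Qed.

Lemma dbullet_empty p : dbullet p empty_diag = p.
Proof.
by case: p => -[|k] P //=; apply/esym/eqP; rewrite -dorder0.
Qed.

Lemma drel_empty x y : drel empty_diag x y = false.
Proof. by apply/idP => /drel_lt. Qed.

Lemma empty_tensor p : dtensor empty_diag p = p.
Proof.
apply: diag_eqP => // x y; rewrite drel_tensor drel_empty /= !subn0.
by case: x y => ? ? [].
Qed.

Lemma tensor_empty p : dtensor p empty_diag = p.
Proof.
apply: diag_eqP => [|x y]; first by rewrite dorder_tensor addn0.
by rewrite drel_tensor drel_empty !andbF orbF.
Qed.

Lemma dtensorA : associative dtensor.
Proof.
move=> p q r; apply: diag_eqP => [|x y]; first by rewrite !dorder_tensor addnA.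
rewrite !drel_tensor /= dorder_tensor -orbA !subnDA; congr (_ || _).
have [le_x|lt_x] := leqP (dorder p) x.2; last first.
  by rewrite (_ : (_ + _ <= x.2) = false) //; lia.
have [le_y|lt_y] := leqP (dorder p) y.2; last first.
  by rewrite (_ : (_ + _ <= y.2) = false) ?andbF //; lia.
by rewrite /= !leq_subRL.
Qed.

(** * Merging two classes of a partial equivalence *)

Section RelMerge.
Variables (T : Type).
Implicit Types R : rel T.

Lemma rel_merge_sym R a b : symmetric R -> symmetric (rel_merge R a b).
Proof. by move=> Rs x y; rewrite /rel_merge Rs andbC. Qed.

Lemma rel_merge_trans R a b : symmetric R -> transitive R -> transitive (rel_merge R a b).
Proof.
move=> Rs Rt y x z.
have ext u v c : R u v -> R c u = R c v.
  by move=> uv; apply/idP/idP => h; apply: (Rt _ _ _ h); rewrite // Rs.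
rewrite /rel_merge => /orP[/[dup] /ext e xy|/andP[ex ey]] /orP[yz|/andP[ey' ez]].
- by rewrite (Rt _ _ _ xy yz).
- by rewrite !e ey' ez orbT.
- by rewrite ex -!(ext _ _ _ yz) ey orbT.
- by rewrite ex ez orbT.
Qed.

Lemma rel_merge_min R R' a b : symmetric R' -> transitive R' ->
  subrel R R' -> R' a b -> subrel (rel_merge R a b) R'.
Proof.
move=> Rs Rt sRR' ab x y; rewrite /rel_merge => /orP[/sRR'//|/andP[ax ay]].
have out z : R a z || R b z -> R' a z.
  by case/orP=> /sRR' // bz; apply: (Rt _ _ _ ab bz).
by apply: (Rt _ _ _ _ (out _ ay)); rewrite Rs out.
Qed.

(* [rel_merge R a b] is the least partial equivalence containing [R] and relating [a]
   and [b]; both sides are hence the least one that relates [a], [b] and [c], [d]. *)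
Lemma rel_mergeC R a b c d : symmetric R -> transitive R ->
    R a a -> R b b -> R c c -> R d d ->
  rel_merge (rel_merge R a b) c d =2 rel_merge (rel_merge R c d) a b.
Proof.
move=> Rs Rt.
have sub a' b' c' d' : R a' a' -> R b' b' -> R c' c' -> R d' d' ->
    subrel (rel_merge (rel_merge R a' b') c' d') (rel_merge (rel_merge R c' d') a' b').
  move=> aa bb cc dd.
  have sub1 u v R1 : subrel R1 (rel_merge R1 u v).
    by move=> x y; rewrite /rel_merge => ->.
  have [sM tM] := (@rel_merge_sym R c' d' Rs, @rel_merge_trans R c' d' Rs Rt).
  have [sM' tM'] := (@rel_merge_sym _ a' b' sM, @rel_merge_trans _ a' b' sM tM).
  apply: rel_merge_min => //; last first.
    by apply: sub1; rewrite /rel_merge cc dd !orbT.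
  apply: rel_merge_min => // [x y xy|]; first by apply/sub1/sub1.
  by rewrite /rel_merge aa bb !orbT.
by move=> aa bb cc dd x y; apply/idP/idP; apply: sub.
Qed.

End RelMerge.

Lemma eq_rel_merge (T : Type) (R R' : rel T) a b :
  R =2 R' -> rel_merge R a b =2 rel_merge R' a b.
Proof. by move=> e x y; rewrite /rel_merge !e. Qed.

(** Pulls a merge out of a tensor product. With its mirror image below, both bracketings of
    [dbullet] become two merges of one triple tensor product, performed in opposite orders, and
    [rel_mergeC] exchanges them. *)
Lemma drel_bullet_tensor p q r : 0 < dorder p -> 0 < dorder q ->
  drel (dtensor (dbullet p q) r) =2
  rel_merge (drel (dtensor (dtensor p q) r)) (true, (dorder p).-1) (true, dorder p).
Proof.
move=> p0 q0 x y.
rewrite drel_tensor dorder_bullet drel_bullet // /rel_merge.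
rewrite !(drel_tensor _ r) !dorder_tensor /=.
have -> : (dorder p + dorder q <= (dorder p).-1) = false by lia.
have -> : (dorder p + dorder q <= dorder p) = false by lia.
by rewrite /= !orbF -!orbA; congr (_ || _); rewrite orbC.
Qed.

Lemma drel_tensor_bullet p q r : 0 < dorder q -> 0 < dorder r ->
  drel (dtensor p (dbullet q r)) =2
  rel_merge (drel (dtensor p (dtensor q r)))
    (true, (dorder p + dorder q).-1) (true, dorder p + dorder q).
Proof.
move=> q0 r0 x y.
rewrite drel_tensor drel_bullet // /rel_merge !(drel_tensor p) /=.
have -> : dorder p <= (dorder p + dorder q).-1 by lia.
have -> : (dorder p + dorder q).-1 - dorder p = (dorder q).-1 by lia.
have out z n : dorder p <= n -> drel p (true, n) z = false.
  by move=> le_n; apply/idP => /drel_lt/andP[/= ? _]; lia.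
rewrite !out ?addKn ?leq_addr //=; lia.
Qed.

Lemma dbulletA : associative dbullet.
Proof.
move=> p q r.
have [/eqP|p0] := posnP (dorder p); first by rewrite dorder0 => /eqP->.
have [/eqP|q0] := posnP (dorder q).
  by rewrite dorder0 => /eqP->; rewrite empty_bullet dbullet_empty.
have [/eqP|r0] := posnP (dorder r); first by rewrite dorder0 => /eqP->; rewrite !dbullet_empty.
apply: diag_eqP => [|x y]; first by rewrite !dorder_bullet addnA.
have [qr0 pq0] : 0 < dorder (dbullet q r) /\ 0 < dorder (dbullet p q).
  by rewrite !dorder_bullet; lia.
rewrite !drel_bullet // (eq_rel_merge _ _ (drel_tensor_bullet _ _ _)) //.
rewrite (eq_rel_merge _ _ (drel_bullet_tensor _ _ _)) // dorder_bullet dtensorA.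
rewrite rel_mergeC // ?drel_refl ?dorder_tensor /=; try lia.
  exact: drel_sym.
by move=> ? ? ?; apply: drel_trans.
Qed.

(** The criterion for [p] to have a left tensor factor of order [j]: no block crosses the line after
    the first [j] columns. *)
Definition splits p j := forall x y, drel p x y -> (x.2 < j) = (y.2 < j).

Lemma splits_tensor p q : splits (dtensor p q) (dorder p).
Proof.
move=> x y; rewrite drel_tensor => /orP[/drel_lt/andP[-> ->]//|/and3P[]].
by rewrite ltnNge => ->; rewrite ltnNge => ->.
Qed.

Definition window_rel p j l : rel (nodes l) := fun x y =>
  drel p (nshift j (nidx x)) (nshift j (nidx y)).

Lemma window_equivalence p j l : j + l <= dorder p ->
  {in [set: nodes l] & &, equivalence_rel (@window_rel p j l)}.
Proof.
move=> le_p x y z _ _ _; rewrite /window_rel.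
split=> [|xy]; first by rewrite drel_refl (leq_trans _ le_p) //= ltn_add2l nidx_lt.
apply/idP/idP => h; last exact: drel_trans xy h.
by apply: drel_trans h; rewrite drel_sym.
Qed.

(** Supplies the two factors of a cut. Blocks that leave the window are truncated, so nothing is
    assumed about them here. *)
Lemma window p j l : j + l <= dorder p ->
  exists2 r, dorder r = l & forall x y,
    drel r x y = [&& x.2 < l, y.2 < l & drel p (nshift j x) (nshift j y)].
Proof.
move=> le_p; exists (Tagged diagram
  (Diagram (equivalence_partitionP (window_equivalence le_p)))) => // x y.
set r := Tagged _ _; have or : dorder r = l by [].
have [/nidx_surj[i <-]|lex] := ltnP x.2 l; last first.
  by rewrite ?andbF; apply/idP => /drel_lt/andP[]; lia.
have [/nidx_surj[i' <-]|ley] := ltnP y.2 l; last first.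
  by rewrite ?andbF; apply/idP => /drel_lt/andP[_]; lia.
rewrite (@drel_pblock r i i') /=.
by rewrite (pblock_equivalence_partition (window_equivalence le_p)) ?inE // !nidx_lt.
Qed.

Lemma splitsP p j : j <= dorder p ->
  splits p j <-> exists r s, [/\ dorder r = j, dorder s = dorder p - j & p = dtensor r s].
Proof.
move=> le_j; split=> [sp|[r [s [<- _ ->]]]]; last exact: splits_tensor.
have [r or rE] := @window p 0 j le_j.
have [|s os sE] := @window p j (dorder p - j); first by lia.
exists r, s; split=> //; apply: diag_eqP => [|x y].
  by rewrite dorder_tensor or os; lia.
rewrite drel_tensor rE sE or /nshift /= !add0n.
(* A related pair lies on one side of the cut and is seen by the window on that side; an unrelated
   pair is seen by neither window. *)
case: (boolP (drel p x y)) => [xy|nxy].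
  have /andP[xp yp] := drel_lt xy; have := sp _ _ xy.
  have [ltx|lex] := ltnP x.2 j; have [lty|ley] := ltnP y.2 j => // _.
    by rewrite -!surjective_pairing xy.
  by rewrite !ltn_sub2r ?(leq_ltn_trans lex) //= !subnKC // -!surjective_pairing xy.
rewrite -!surjective_pairing (negbTE nxy) !andbF /=; apply/esym/idP => /and5P[lex ley _ _].
by rewrite !subnKC // -!surjective_pairing (negbTE nxy).
Qed.

(** * Unique factorization *)

Definition letter (p : diag) := p != empty_diag /\ irreducible p.

Definition word (u : seq diag) := {in u, forall a, letter a}.

Lemma dorder_gt0 p : (0 < dorder p) = (p != empty_diag).
Proof. by rewrite lt0n dorder0. Qed.

Lemma irreducibleP p :
  irreducible p <-> forall j, 0 < j < dorder p -> ~ splits p j.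
Proof.
split=> [irr j /andP[j0 jp]|ns [r [s [r0 s0 ep]]]].
  move=> /(splitsP (ltnW jp))[r [s [er es ep]]]; case: irr.
  by exists r, s; rewrite -!dorder_gt0 er es subn_gt0.
move: r0 s0 ns; rewrite -!dorder_gt0 ep => r0 s0 /(_ (dorder r)).
by apply; [rewrite dorder_tensor r0 -ltn_subLR ?subnn|apply: splits_tensor].
Qed.

Lemma tensor_cancel p q p' q' : dorder p = dorder p' ->
  dtensor p q = dtensor p' q' -> p = p' /\ q = q'.
Proof.
move=> epp' e; have eqq' : dorder q = dorder q'.
  by have /(congr1 dorder) := e; rewrite !dorder_tensor; lia.
have E x y : drel (dtensor p q) x y = drel (dtensor p' q') x y by rewrite e.
split; apply: diag_eqP => // x y.
  have := E x y; rewrite !drel_tensor -epp'.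
  have [ltx|lex] := ltnP x.2 (dorder p); first by rewrite !orbF.
  move=> _; apply/idP/idP => /drel_lt/andP[]; lia.
have := E (nshift (dorder p) x) (nshift (dorder p) y).
rewrite !drel_tensor /nshift /= -!epp' !leq_addr !addKn -!surjective_pairing.
have out r : dorder r = dorder p -> drel r (x.1, dorder p + x.2) (y.1, dorder p + y.2) = false.
  by move=> er; apply/idP => /drel_lt/andP[/= ]; lia.
by rewrite !out.
Qed.

(** Merging only adds relations, so each cut of the merge is a cut of the tensor product. The merged
    block has nodes on both sides of the line between [p] and [q], which excludes that cut. *)
Lemma splits_bullet p q j : 0 < dorder p -> 0 < dorder q -> splits (dbullet p q) j ->
  [/\ j < dorder p -> splits p j, j != dorder p &
      dorder p < j -> splits q (j - dorder p)].
Proof.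
move=> p0 q0 sp; have E := drel_bullet p0 q0.
have sub : subrel (drel (dtensor p q)) (drel (dbullet p q)).
  by move=> x y xy; rewrite E /rel_merge xy.
split=> [jp x y xy| |pj x y xy].
- by apply/sp/sub; rewrite drel_tensor xy.
- apply/eqP => ej; have := sp (true, (dorder p).-1) (true, dorder p).
  have self n : n < dorder p + dorder q -> drel (dtensor p q) (true, n) (true, n).
    by rewrite drel_refl.
  by rewrite E /rel_merge !self ?orbT => [/(_ isT) /=||]; lia.
- have := sp (nshift (dorder p) x) (nshift (dorder p) y).
  rewrite /= !ltn_subRL; apply; apply: sub; rewrite drel_tensor /nshift /=.
  by rewrite !leq_addr !addKn -!surjective_pairing xy orbT.
Qed.

Lemma letter_bullet p q : letter p -> letter q -> letter (dbullet p q).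
Proof.
move=> [p0 ip] [q0 iq]; split.
  by rewrite -dorder_gt0 dorder_bullet addn_gt0 dorder_gt0 p0.
rewrite -dorder_gt0 in p0; rewrite -dorder_gt0 in q0.
apply/irreducibleP => j; rewrite dorder_bullet => /andP[j0 jpq].
move=> /splits_bullet[//|//|sp /eqP jp sq].
have [ltj|ltj|//] := ltngtP j (dorder p).
  by apply: ((irreducibleP p).1 ip j) (sp ltj); rewrite j0.
by apply: ((irreducibleP q).1 iq _) (sq ltj); rewrite subn_gt0 ltj ltn_subLR // ltnW.
Qed.

(** If the orders of [a] and [b] differed, the end of the shorter letter would be a cut of the
    longer one, against irreducibility. With equal orders both factors can be read off. *)
Lemma letter_tensor_inj a b p q : letter a -> letter b ->
  dtensor a p = dtensor b q -> a = b /\ p = q.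
Proof.
have lt_absurd a' b' p' q' : letter a' -> letter b' ->
    dtensor a' p' = dtensor b' q' -> dorder a' < dorder b' -> False.
  move=> [a0 _] [_ ib] e ltab; apply: ((irreducibleP b').1 ib (dorder a')).
    by rewrite dorder_gt0 a0.
  move=> x y xy; apply: (@splits_tensor a' p').
  by rewrite e drel_tensor xy.
move=> la lb e; have [ltab|ltba|eab] := ltngtP (dorder a) (dorder b).
- by case: (lt_absurd _ _ _ _ la lb e).
- by case: (lt_absurd _ _ _ _ lb la (esym e)).
- exact: tensor_cancel.
Qed.

Lemma word_cons a u : word (a :: u) <-> letter a /\ word u.
Proof.
split=> [w|[la wu] b]; last by rewrite inE => /predU1P[->//|/wu].
by split=> [|b bu]; apply: w; rewrite inE ?eqxx // bu orbT.
Qed.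

Lemma word_cat u v : word u -> word v -> word (u ++ v).
Proof. by move=> wu wv a; rewrite mem_cat => /orP[/wu|/wv]. Qed.

Lemma dtensor_seq_cat u v : dtensor_seq (u ++ v) = dtensor (dtensor_seq u) (dtensor_seq v).
Proof. by elim: u => [|a u IHu] /=; rewrite ?empty_tensor // IHu dtensorA. Qed.

Lemma factorization_exists p : exists u, is_factorization p u.
Proof.
have [n] := ubnP (dorder p); elim: n p => // n IHn p; rewrite ltnS => le_p.
have [->|p0] := eqVneq p empty_diag; first by exists [::].
have [ip|] := EM (irreducible p).
  exists [:: p]; split; first by rewrite /= tensor_empty.
  by move=> r; rewrite inE => /eqP->.
move=> /contrapT[r [s [r0 s0 ep]]]; move: le_p; rewrite -dorder_gt0 in r0.
rewrite -dorder_gt0 in s0; rewrite ep dorder_tensor => le_p.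
have [|u [eu wu]] := IHn r; first by lia.
have [|v [ev wv]] := IHn s; first by lia.
by exists (u ++ v); split; [rewrite dtensor_seq_cat -eu -ev|exact: word_cat].
Qed.

Lemma dtensor_seq_eq_empty u : word u -> dtensor_seq u = empty_diag -> u = [::].
Proof.
case: u => // a u /word_cons[[a0 _] _] /= /eqP.
by rewrite -dorder0 dorder_tensor addn_eq0 dorder0 (negbTE a0).
Qed.

Lemma dtensor_seq_inj u v : word u -> word v -> dtensor_seq u = dtensor_seq v -> u = v.
Proof.
elim: u v => [|a u IHu] v wu wv; first by move/esym/(dtensor_seq_eq_empty wv).
case: v wv => [|b v] wv; first by move/(dtensor_seq_eq_empty wu).
move/word_cons: wu wv => [la wu] /word_cons[lb wv] /= /letter_tensor_inj[] // -> e.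
by congr (_ :: _); apply: IHu.
Qed.

Definition factors (p : diag) : seq diag := sval (cid (factorization_exists p)).

Lemma factorsP p : is_factorization p (factors p).
Proof. exact: svalP (cid (factorization_exists p)). Qed.

Lemma word_factors p : word (factors p).
Proof. by have [] := factorsP p. Qed.

Lemma factorsK : cancel factors dtensor_seq.
Proof. by move=> p; have [<-] := factorsP p. Qed.

Lemma dtensor_seqK u : word u -> factors (dtensor_seq u) = u.
Proof. by move=> wu; apply: dtensor_seq_inj; rewrite ?factorsK //; apply: word_factors. Qed.

(** Ensures that the recursive case of [split_seq] misses no splitting with a nonempty left part. *)
Lemma tensor_prefix a p r s : letter a -> r != empty_diag -> dtensor r s = dtensor a p ->
  exists2 r', r = dtensor a r' & dtensor r' s = p.
Proof.
move=> la r0; have := @word_factors r; rewrite -{2 3}(factorsK r).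
case: (factors r) (factorsK r) r0 => [/= <-|b u _ _ /word_cons[lb wu]].
  by rewrite eqxx.
rewrite -dtensorA => /(letter_tensor_inj lb la)[-> e].
by exists (dtensor_seq u).
Qed.

(** * Splittings and quasi-shuffles of words *)

(* Not imported above, where they would hide [partition], [pblock] and [set] of finset. *)
From mathcomp Require Import finmap classical_sets cardinality fsbigop monalg.

Local Open Scope ring_scope.

Lemma is_factorizationP p s : is_factorization p s <-> s = factors p.
Proof.
split=> [[-> ws]|->]; first by rewrite dtensor_seqK.
exact: factorsP.
Qed.

Lemma dbullet_eq_empty p q :
  (dbullet p q == empty_diag) = (p == empty_diag) && (q == empty_diag).
Proof. by rewrite -!dorder0 dorder_bullet addn_eq0. Qed.

(** A list without repetitions of the [splittings] of a word, by the number of letters that go to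
    the left. *)
Fixpoint split_seq (u : seq diag) : seq (diag * diag) :=
  (empty_diag, dtensor_seq u) ::
  if u is a :: u' then [seq (dtensor a rs.1, rs.2) | rs <- split_seq u'] else [::].

Lemma mem_split_seq u rs : word u ->
  (rs \in split_seq u) = (dtensor rs.1 rs.2 == dtensor_seq u).
Proof.
case: rs => r s /=; elim: u r s => [|a u IHu] r s.
  by rewrite /= inE xpair_eqE -!dorder0 dorder_tensor addn_eq0.
move=> /word_cons[la wu]; rewrite /= inE.
apply/predU1P/eqP => [[[-> ->]|/mapP[[r' s'] /= rs' [-> ->]]]|e].
- by rewrite empty_tensor.
- by move: rs'; rewrite IHu // -dtensorA => /eqP->.
have [er|r0] := eqVneq r empty_diag; [left|right].
  by move: e; rewrite er empty_tensor => ->.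
have [r' er e'] := tensor_prefix la r0 e.
by apply/mapP; exists (r', s); rewrite ?IHu ?er // e'.
Qed.

Lemma uniq_split_seq u : word u -> uniq (split_seq u).
Proof.
elim: u => //= a u IHu /word_cons[la wu]; rewrite map_inj_in_uniq ?IHu // ?andbT.
  apply/mapP => -[rs _ /(congr1 fst)/= e]; case: la => + _.
  by move/esym/eqP: e; rewrite -dorder0 dorder_tensor addn_eq0 dorder0 => /andP[/eqP->];
    rewrite eqxx.
move=> [r s] [r' s'] _ _ /= e.
have /= es := congr1 snd e; have /= er := congr1 fst e.
by have [_ ->] := letter_tensor_inj la la er; rewrite es.
Qed.

Lemma sum_splittings (V : nmodType) (F : diag * diag -> V) u : word u ->
  \sum_(rs \in splittings (dtensor_seq u)) F rs = \sum_(rs <- split_seq u) F rs.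
Proof.
move=> wu; rewrite (fsbig_seq _ _ (uniq_split_seq wu)); apply: eq_fsbigl.
rewrite /splittings; apply/seteqP; split=> rs /=; rewrite mem_split_seq //.
  by move->.
by move/eqP.
Qed.

Section QuasiShuffles.

(** The first pair takes a letter from [u], from [v], or from both; a pair of empty diagrams never
    occurs. The inner [fix] is there because the second choice shortens only [v]. *)
Fixpoint qshuffle (u : seq diag) : seq diag -> seq (seq (diag * diag)) :=
  if u is a :: u' then
    fix qshuffle_u v :=
      if v is b :: v' then
        [seq (a, empty_diag) :: t | t <- qshuffle u' v] ++
        [seq (empty_diag, b) :: t | t <- qshuffle_u v'] ++
        [seq (a, b) :: t | t <- qshuffle u' v']
      else [:: [seq (c, empty_diag) | c <- u]]
  else fun v => [:: [seq (empty_diag, c) | c <- v]].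

Lemma qshuffle0s v : qshuffle [::] v = [:: [seq (empty_diag, c) | c <- v]].
Proof. by []. Qed.

Lemma qshuffles0 u : qshuffle u [::] = [:: [seq (c, empty_diag) | c <- u]].
Proof. by case: u. Qed.

Lemma qshuffle_cons a u b v : qshuffle (a :: u) (b :: v) =
  [seq (a, empty_diag) :: t | t <- qshuffle u (b :: v)] ++
  [seq (empty_diag, b) :: t | t <- qshuffle (a :: u) v] ++
  [seq (a, b) :: t | t <- qshuffle u v].
Proof. by []. Qed.

Arguments qshuffle : simpl never.

Let nonempty := predC1 empty_diag.
Let padded (rs : diag * diag) := (rs.1 != empty_diag) || (rs.2 != empty_diag).

Lemma mem_cons_map (T : eqType) (x y : T) s (S : seq (seq T)) :
  (y :: s \in [seq x :: t | t <- S]) = (y == x) && (s \in S).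
Proof.
apply/mapP/andP => [[t tS [-> ->]]|[/eqP-> sS]]; first by rewrite eqxx.
by exists s.
Qed.

(** By induction on [t]: which components of its first pair are empty decides which of the three
    lists can contain it. The predicate [padded] expresses that the two components have a nonempty
    merge. *)
Lemma mem_qshuffle t u v : all nonempty u -> all nonempty v ->
  (t \in qshuffle u v) =
  [&& [seq r <- unzip1 t | nonempty r] == u, [seq s <- unzip2 t | nonempty s] == v &
      all padded t].
Proof.
elim: t u v => [|[r s] t IHt] u v nu nv.
  case: u v nu nv => [|a u] [|b v] _ _ //; rewrite ?qshuffle_cons //.
  rewrite !mem_cat andbF; apply/negP.
  by case/or3P=> /mapP[].
have mem_pad (w : seq diag) (f : diag -> diag * diag) (x : diag * diag) :
  (x :: t \in [:: map f w]) =
  if w is c :: w' then (x == f c) && (t \in [:: map f w']) else false.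
  by rewrite inE; case: w => //= c w; rewrite eqseq_cons inE.
rewrite /= /padded /=.
case: u v nu nv => [|a u] [|b v] nu nv.
- rewrite mem_pad; case: (r =P _) => //=; case: (s =P _) => //=; by rewrite ?andbF.
- rewrite mem_pad -qshuffle0s; case/andP: nv => /= nb nv.
  rewrite IHt // xpair_eqE; have [_|//] := eqVneq r empty_diag.
  have [->|s0] /= := eqVneq s empty_diag; rewrite ?andbF //.
    by rewrite eq_sym (negbTE nb).
  by rewrite eqseq_cons /=; case: (s == b); rewrite //= andbF.
- rewrite qshuffles0 mem_pad -qshuffles0; case/andP: nu => /= na nu.
  rewrite IHt // xpair_eqE; have [->|r0] /= := eqVneq r empty_diag.
    by rewrite eq_sym (negbTE na) /=; case: (s == _); rewrite /= ?andbF.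
  have [_|_] /= := eqVneq s empty_diag; rewrite ?andbF //.
  by rewrite eqseq_cons andbT; case: (r == a).
- have /andP[/= na nu'] := nu; have /andP[/= nb nv'] := nv.
  rewrite qshuffle_cons !mem_cat !mem_cons_map !xpair_eqE !IHt //.
  have [->|r0] /= := eqVneq r empty_diag.
    rewrite (eq_sym _ a) (negbTE na) /=.
    have [->|s0] /= := eqVneq s empty_diag; first by rewrite (eq_sym _ b) (negbTE nb) !andbF.
    by rewrite eqseq_cons orbF; case: (s == b); rewrite //= andbF.
  have [->|s0] /= := eqVneq s empty_diag.
    by rewrite !(eq_sym _ b) (negbTE nb) !andbF !orbF eqseq_cons andbT; case: (r == a).
  by rewrite !andbF /= !eqseq_cons; case: (r == a); case: (s == b); rewrite //= andbF.
Qed.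

Lemma uniq_qshuffle u v : all nonempty u -> all nonempty v -> uniq (qshuffle u v).
Proof.
elim: u v => // a u IHu v /= /[dup] nu /andP[na nu'].
elim: v => // b v IHv /= /[dup] nv /andP[nb nv'].
rewrite -/(qshuffle (a :: u) v).
have cons_inj (x : diag * diag) : injective (cons x) by move=> t t' [].
rewrite !cat_uniq !map_inj_uniq // IHu //= IHv // IHu //= has_cat.
rewrite !andbT; apply/andP; split.
  apply/norP; split; apply/hasPn => _ /mapP[t _ ->]; rewrite mem_cons_map xpair_eqE.
    by rewrite eq_sym (negbTE na).
  by rewrite (negbTE nb) andbF.
by apply/hasPn => _ /mapP[t _ ->]; rewrite mem_cons_map xpair_eqE (negbTE na).
Qed.

Lemma word_nonempty u : word u -> all nonempty u.
Proof. by move=> wu; apply/allP => a /wu[]. Qed.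

Lemma sum_quasi_shuffles (V : nmodType) (F : seq (diag * diag) -> V) u v : word u -> word v ->
  \sum_(t \in quasi_shuffles (dtensor_seq u) (dtensor_seq v)) F t =
  \sum_(t <- qshuffle u v) F t.
Proof.
move=> wu wv; have [nu nv] := (word_nonempty wu, word_nonempty wv).
rewrite (fsbig_seq _ _ (uniq_qshuffle nu nv)); apply: eq_fsbigl.
rewrite /quasi_shuffles; apply/seteqP; split=> t /=; rewrite mem_qshuffle //.
  move=> [/is_factorizationP-> /is_factorizationP->]; rewrite !dtensor_seqK // !eqxx /=.
  by move=> nt; apply/allP => -[r s] /nt; rewrite dbullet_eq_empty negb_and.
move=> /and3P[/eqP eu /eqP ev /allP nt]; split.
- by apply/is_factorizationP; rewrite dtensor_seqK.
- by apply/is_factorizationP; rewrite dtensor_seqK.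
- by move=> rs /nt; rewrite dbullet_eq_empty negb_and.
Qed.

End QuasiShuffles.

(** * Sums over deconcatenations and linear maps on tensor products *)

Section DSum.
Variable V : zmodType.
Implicit Types F G : seq diag -> seq diag -> V.

Fixpoint dsum F (u : seq diag) : V :=
  if u is a :: u' then F [::] u + dsum (fun v w => F (a :: v) w) u'
  else F [::] [::].

(** The premise [v ++ w = u] matters when [u] is a word: it shows that [v] and [w] are words too,
    which the formulas for [wordM] require. *)
Lemma eq_dsum F G u : (forall v w, v ++ w = u -> F v w = G v w) -> dsum F u = dsum G u.
Proof.
elim: u F G => [|a u IHu] F G FG /=; first by rewrite FG.
by rewrite FG //; congr (_ + _); apply: IHu => v w e; rewrite FG //= e.
Qed.

Lemma dsum0 u : dsum (fun _ _ => 0) u = 0.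
Proof. by elim: u => //= a u ->; rewrite addr0. Qed.

Lemma dsumD F G u : dsum (fun v w => F v w + G v w) u = dsum F u + dsum G u.
Proof. by elim: u F G => //= a u IHu F G; rewrite IHu addrACA. Qed.

Lemma dsum_split_seq (F : diag * diag -> V) u :
  \sum_(rs <- split_seq u) F rs = dsum (fun v w => F (dtensor_seq v, dtensor_seq w)) u.
Proof.
elim: u F => [|a u IHu] F /=; first by rewrite big_seq1.
by rewrite big_cons big_map IHu.
Qed.

End DSum.

Lemma dsum_morph (V W : zmodType) (f : V -> W) F u : {morph f : x y / x + y} ->
  f (dsum F u) = dsum (fun v w => f (F v w)) u.
Proof. by move=> fD; elim: u F => //= a u IHu F; rewrite fD IHu. Qed.

(** Both sides run over the cuts of [u] into three pieces. Coassociativity and the associativity of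
    convolution both rest on this. *)
Lemma dsumA (V : zmodType) (F : seq diag -> seq diag -> seq diag -> V) u :
  dsum (fun v w => dsum (fun v1 v2 => F v1 v2 w) v) u =
  dsum (fun v w => dsum (fun w1 w2 => F v w1 w2) w) u.
Proof.
by elim: u F => //= a u IHu F; rewrite dsumD -IHu addrA.
Qed.

Section UnbundledLinear.
Variable K : fieldType.
Implicit Types U V W : lmodType K.

(** The structures to be established state linearity as a property of plain functions, so the usual
    consequences are derived in that form. *)
Lemma linear_morphD U V (f : U -> V) : linear f -> {morph f : x y / x + y}.
Proof. by move=> fl x y; have := fl 1 x y; rewrite !scale1r. Qed.

Lemma linear_morph0 U V (f : U -> V) : linear f -> f 0 = 0.
Proof.
move=> fl; have /(congr1 (fun x => x - f 0)) := linear_morphD fl 0 0.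
by rewrite addr0 addrK subrr.
Qed.

Lemma linear_morphZ U V (f : U -> V) a : linear f -> {morph f : x / a *: x}.
Proof. by move=> fl x; have := fl a x 0; rewrite (linear_morph0 fl) !addr0. Qed.

Lemma linear_morph_sum U V (f : U -> V) I (r : seq I) (F : I -> U) : linear f ->
  f (\sum_(i <- r) F i) = \sum_(i <- r) f (F i).
Proof. by move=> fl; exact: (big_morph f (linear_morphD fl) (linear_morph0 fl)). Qed.

Lemma linear_idfun U : linear (@id U).
Proof. by []. Qed.

Lemma linear_compf U V W (f : V -> W) (g : U -> V) :
  linear f -> linear g -> linear (fun x => f (g x)).
Proof. by move=> fl gl a x y; rewrite gl fl. Qed.

Lemma linear_addf U V (f g : U -> V) : linear f -> linear g -> linear (fun x => f x + g x).
Proof. by move=> fl gl a x y; rewrite fl gl scalerDr addrACA. Qed.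

Lemma linear_sumf U V I (r : seq I) (f : I -> U -> V) : (forall i, linear (f i)) ->
  linear (fun x => \sum_(i <- r) f i x).
Proof.
move=> fl a x y; rewrite scaler_sumr -big_split.
by apply: eq_bigr => i _; rewrite fl.
Qed.

Lemma linear_scalef U V (f : U -> K^o) (v : V) : scalar f -> linear (fun x => f x *: v).
Proof. by move=> fl a x y; rewrite fl scalerDl scalerA. Qed.

Lemma linear_tlift U V W W' (F : W' -> U -> V -> W) t :
  (forall u v, linear (fun w => F w u v)) -> linear (fun w => tlift (F w) t).
Proof. by move=> Fl; apply: linear_sumf => p; apply: Fl. Qed.

Lemma bilinear_tmap U V U' V' (f : U -> U') (g : V -> V') : linear f -> linear g ->
  bilinear (fun (u : U) (v : V) => f u \ox g v).
Proof.
move=> fl gl; have [tl tr] := @tpure_bilinear _ U' V'.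
by split=> [v a u u'|u a v v'] /=; [rewrite fl tl|rewrite gl tr].
Qed.

Lemma linear_tmap U V U' V' (f : U -> U') (g : V -> V') : linear f -> linear g ->
  linear (tmap f g).
Proof. by move=> fl gl; apply/tlift_linear/bilinear_tmap. Qed.

Lemma tmapE U V U' V' (f : U -> U') (g : V -> V') u v : linear f -> linear g ->
  tmap f g (u \ox v) = f u \ox g v.
Proof. by move=> fl gl; rewrite /tmap tliftE //; apply: bilinear_tmap. Qed.

Lemma bilinear_tassocf U V W (w : W) : bilinear (fun (u : U) (v : V) => u \ox (v \ox w)).
Proof.
have [tl tr] := @tpure_bilinear _ U (tensor V W); have [tl' _] := @tpure_bilinear _ V W.
by split=> [v a u u'|u a v v'] /=; [rewrite tl|rewrite tl' tr].
Qed.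

Lemma bilinear_tassoc U V W :
  bilinear (fun (x : U \ox V) (w : W) => tlift (fun u v => u \ox (v \ox w)) x).
Proof.
split=> [w|x]; first exact/tlift_linear/bilinear_tassocf.
apply: linear_tlift => u v; apply: linear_compf; first exact: (tpure_bilinear _ _).2.
exact: (tpure_bilinear _ _).2.
Qed.

Lemma linear_tassoc U V W : linear (@tassoc K U V W).
Proof. exact/tlift_linear/bilinear_tassoc. Qed.

Lemma tassocE U V W (u : U) (v : V) (w : W) :
  tassoc ((u \ox v) \ox w) = u \ox (v \ox w).
Proof.
rewrite /tassoc tliftE; last exact: bilinear_tassoc.
by rewrite tliftE //; apply: bilinear_tassocf.
Qed.

Lemma bilinear_tmulf U (mul : U -> U -> U) a b : bilinear mul ->
  bilinear (fun (c d : U) => mul a c \ox mul b d).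
Proof. by move=> [_ mr]; apply: bilinear_tmap; apply: mr. Qed.

Lemma bilinear_tmul U (mul : U -> U -> U) : bilinear mul -> bilinear (tmul mul).
Proof.
move=> /[dup] mb [ml mr].
have tlinl t : bilinear (fun (a b : U) => tlift (fun c d => mul a c \ox mul b d) t).
  split=> [b|a]; apply: linear_tlift => c d.
    by apply: (linear_compf (f := tpure^~ _)); [exact: (tpure_bilinear _ _).1|exact: ml].
  by apply: linear_compf; [exact: (tpure_bilinear _ _).2|exact: ml].
split=> [t|s]; first exact/tlift_linear/tlinl.
by apply: linear_sumf => p; apply/tlift_linear/bilinear_tmulf.
Qed.

Lemma tmulE U (mul : U -> U -> U) a b c d : bilinear mul ->
  tmul mul (a \ox b) (c \ox d) = mul a c \ox mul b d.
Proof.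
move=> mb; rewrite /tmul.
have -> : (fun a b => tlift (fun c d => mul a c \ox mul b d) (c \ox d)) =
    (fun a b => mul a c \ox mul b d).
  by apply/funext => a'; apply/funext => b'; rewrite tliftE //; apply: bilinear_tmulf.
by rewrite tliftE //; apply: bilinear_tmap; apply: mb.1.
Qed.

Lemma is_subspace_sum V (P : V -> Prop) I (r : seq I) (F : I -> V) : is_subspace P ->
  (forall i, P (F i)) -> P (\sum_(i <- r) F i).
Proof.
move=> [P0 PD] PF; elim/big_ind: _ => // x y Px Py.
by rewrite -[x]scale1r; apply: PD.
Qed.

Lemma is_subspaceD V (P : V -> Prop) x y : is_subspace P -> P x -> P y -> P (x + y).
Proof. by move=> [_ PD] Px Py; rewrite -[x]scale1r; apply: PD. Qed.

Lemma is_subspaceZ V (P : V -> Prop) a x : is_subspace P -> P x -> P (a *: x).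
Proof. by move=> [P0 PD] Px; rewrite -[_ *: _]addr0; apply: PD. Qed.

Lemma is_subspaceN V (P : V -> Prop) x : is_subspace P -> P x -> P (- x).
Proof. by move=> sP Px; rewrite -scaleN1r; apply: is_subspaceZ. Qed.

End UnbundledLinear.

(** * The product *)

(* Locked, as unification may otherwise unfold two distinct words down to their set
   partitions before failing. *)
HB.lock Definition wordM (K : fieldType) (u : seq diag) : ParQSym K :=
  M K (dtensor_seq u).

HB.lock Definition prepend (K : fieldType) (a : diag) : ParQSym K -> ParQSym K :=
  lin_ext (fun p => M K (dtensor a p)).

HB.lock Definition qmul (K : fieldType) : ParQSym K -> ParQSym K -> ParQSym K :=
  @ParQSym_mul K.

Section ParQSymStructure.
Variable K : fieldType.
Notation H := (ParQSym K).
Notation M := (@M K).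
Notation wordM := (@wordM K).
Notation prepend := (@prepend K).
Notation mul := (@qmul K).
Implicit Types (V : lmodType K) (x y z : H) (u v w : seq diag).

(** Lets several elements be summed over one common set of diagrams, on which linearity is checked
    term by term. *)
Lemma lin_extEw V (f : diag -> V) x (D : {fset diag}) : (msupp x `<=` D)%fset ->
  lin_ext f x = \sum_(p <- D) x@_p *: f p.
Proof.
move=> sD; apply: big_fset_incl => // p _ pD.
by rewrite mcoeff_outdom // scale0r.
Qed.

Lemma lin_ext_linear V (f : diag -> V) : linear (lin_ext f).
Proof.
move=> a x y; pose D := (msupp (a *: x + y) `|` (msupp x `|` msupp y))%fset.
rewrite !(@lin_extEw _ _ _ D) ?fsubsetUl //.
- rewrite scaler_sumr -big_split; apply: eq_bigr => p _ /=.
  by rewrite mcoeffD mcoeffZ scalerDl scalerA.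
- by apply: fsubset_trans (fsubsetUr _ _); apply: fsubsetUr.
- by apply: fsubset_trans (fsubsetUr _ _); apply: fsubsetUl.
Qed.

Lemma lin_extE V (f : diag -> V) p : lin_ext f (M p) = f p.
Proof.
rewrite (@lin_extEw _ _ _ [fset p]%fset) ?msuppU_le //.
by rewrite big_seq_fset1 mcoeffUU scale1r.
Qed.

Lemma ParQSym_expand x : x = \sum_(p <- msupp x) x@_p *: M p.
Proof.
rewrite {1}[x]monalgE; apply: eq_bigr => p _.
by apply/malgP => q; rewrite mcoeffZ !mcoeffU mulrnAr mulr1.
Qed.

Lemma linear_eq_M V (f g : H -> V) : linear f -> linear g ->
  (forall p, f (M p) = g (M p)) -> f =1 g.
Proof.
move=> fl gl e x; rewrite [x]ParQSym_expand !linear_morph_sum //.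
by apply: eq_bigr => p _; rewrite !linear_morphZ ?e.
Qed.

Lemma wordME u : wordM u = M (dtensor_seq u).
Proof. by rewrite wordM.unlock. Qed.

Lemma linear_eq_word V (f g : H -> V) : linear f -> linear g ->
  (forall u, word u -> f (wordM u) = g (wordM u)) -> f =1 g.
Proof.
move=> fl gl e; apply: linear_eq_M => // p; rewrite -(factorsK p).
by rewrite -wordME; exact/e/word_factors.
Qed.

Lemma prepend_linear a : linear (prepend a).
Proof. rewrite prepend.unlock; exact: lin_ext_linear. Qed.

Lemma prepend_wordM a u : prepend a (wordM u) = wordM (a :: u).
Proof. rewrite prepend.unlock !wordME; exact: lin_extE. Qed.

Lemma mul_bilinear : bilinear mul.
Proof.
rewrite qmul.unlock; split=> [y|x]; first exact: lin_ext_linear.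
apply: linear_sumf => p; move=> a y y'.
by rewrite lin_ext_linear scalerDr !scalerA mulrC.
Qed.
Let mulDl := fun y => linear_morphD (mul_bilinear.1 y).
Let mulDr := fun x => linear_morphD (mul_bilinear.2 x).

Lemma mul_wordM u v : word u -> word v ->
  mul (wordM u) (wordM v) =
  \sum_(t <- qshuffle u v) wordM [seq dbullet rs.1 rs.2 | rs <- t].
Proof.
move=> wu wv; rewrite !wordME qmul.unlock /ParQSym_mul !lin_extE sum_quasi_shuffles //.
by apply: eq_bigr => t _; rewrite wordME.
Qed.

Lemma mul1x x : mul (wordM [::]) x = x.
Proof.
move: x; apply: linear_eq_word; [exact: mul_bilinear.2|by []|move=> u wu].
rewrite mul_wordM // qshuffle0s big_seq1 -map_comp map_id_in //.
Qed.

Lemma mulx1 x : mul x (wordM [::]) = x.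
Proof.
move: x; apply: (@linear_eq_word _ (mul^~ _)); [exact: mul_bilinear.1|by []|move=> u wu].
rewrite mul_wordM // qshuffles0 big_seq1 -map_comp map_id_in // => a _; apply: dbullet_empty.
Qed.

(** Stated for arbitrary [x] and [y], since associativity applies it to arguments that are
    themselves products and not words. *)
Lemma mul_prepend a b x y : letter a -> letter b ->
  mul (prepend a x) (prepend b y) =
  prepend a (mul x (prepend b y)) + prepend b (mul (prepend a x) y) +
  prepend (dbullet a b) (mul x y).
Proof.
move=> la lb.
have [ml mr] := mul_bilinear; have pl c : linear (prepend c) := @prepend_linear c.
have comp (f g : H -> H) (fl : linear f) (gl : linear g) : linear (fun x => f (g x)).
  exact: (@linear_compf K H H H f g).
have add (f g : H -> H) (fl : linear f) (gl : linear g) : linear (fun x => f x + g x).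
  exact: (@linear_addf K H H f g).
have lx : linear (fun x => mul (prepend a x) (prepend b y)).
  exact: comp (ml (prepend b y)) (pl a).
have rx : linear (fun x => prepend a (mul x (prepend b y)) + prepend b (mul (prepend a x) y) +
    prepend (dbullet a b) (mul x y)).
  apply: add (add _ _ (comp _ _ (pl a) (ml (prepend b y))) _) (comp _ _ (pl _) (ml y)).
  exact: comp (pl b) (comp _ _ (ml y) (pl a)).
apply: (linear_eq_word lx rx) => u wu.
have ly : linear (fun y => mul (prepend a (wordM u)) (prepend b y)).
  exact: comp (mr _) (pl b).
have ry : linear (fun y => prepend a (mul (wordM u) (prepend b y)) +
    prepend b (mul (prepend a (wordM u)) y) + prepend (dbullet a b) (mul (wordM u) y)).
  apply: add (add _ _ _ (comp _ _ (pl b) (mr _))) (comp _ _ (pl _) (mr _)).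
  exact: comp (pl a) (comp _ _ (mr _) (pl b)).
apply: (linear_eq_word ly ry) => v wv; rewrite {lx rx ly ry}.
have [wau wbv] : word (a :: u) /\ word (b :: v) by split; apply/word_cons.
rewrite !prepend_wordM !mul_wordM // qshuffle_cons !big_cat !big_map /= addrA.
rewrite !(linear_morph_sum _ _ (pl _)).
(* The first pairs of the three lists merge to [a], [b] and [dbullet a b]. *)
congr (_ + _ + _); apply: eq_bigr => t _; rewrite prepend_wordM //=.
by rewrite dbullet_empty.
Qed.

Lemma mulA_wordM u v w : word u -> word v -> word w ->
  mul (wordM u) (mul (wordM v) (wordM w)) = mul (mul (wordM u) (wordM v)) (wordM w).
Proof.
have [n] := ubnP (size u + size v + size w)%N.
elim: n u v w => // n IHn [|a u] [|b v] [|c w] le_n;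
  rewrite ?mul1x ?mulx1 //.
move=> /[dup] wau /word_cons[la wu] /[dup] wbv /word_cons[lb wv] /[dup] wcw /word_cons[lc ww].
have [lab lbc] := (letter_bullet la lb, letter_bullet lb lc).
rewrite /= in le_n; rewrite -!prepend_wordM.
set x := wordM u; set y := wordM v; set z := wordM w.
(* The induction hypothesis for the seven ways to remove the first letter from at least one of the
   three words. *)
have A1 : mul x (mul (prepend b y) (prepend c z)) = mul (mul x (prepend b y)) (prepend c z).
  by rewrite !prepend_wordM; apply: IHn => //=; lia.
have A2 : mul (prepend a x) (mul y (prepend c z)) = mul (mul (prepend a x) y) (prepend c z).
  by rewrite !prepend_wordM; apply: IHn => //=; lia.
have A3 : mul (prepend a x) (mul (prepend b y) z) = mul (mul (prepend a x) (prepend b y)) z.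
  by rewrite !prepend_wordM; apply: IHn => //=; lia.
have A4 : mul x (mul y (prepend c z)) = mul (mul x y) (prepend c z).
  by rewrite !prepend_wordM; apply: IHn => //=; lia.
have A5 : mul x (mul (prepend b y) z) = mul (mul x (prepend b y)) z.
  by rewrite !prepend_wordM; apply: IHn => //=; lia.
have A6 : mul (prepend a x) (mul y z) = mul (mul (prepend a x) y) z.
  by rewrite !prepend_wordM; apply: IHn => //=; lia.
have A7 : mul x (mul y z) = mul (mul x y) z by apply: IHn => //=; lia.
have pD d := linear_morphD (@prepend_linear d).
rewrite (mul_prepend y z lb lc) (mul_prepend x y la lb).
rewrite !(mulDl, mulDr) !mul_prepend //.
(* [A1] is used backwards: on the left its term is already spread over three summands, so the
   right-hand side is regrouped to be expanded in the same way. [A3] does the symmetric thing on the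
   left. Each side then has eleven terms. *)
rewrite -A1 A2 A3 A4 A5 A6 A7 (mul_prepend y z lb lc) (mul_prepend x y la lb) dbulletA.
rewrite !(mulDl, mulDr, pD) !addrA.
by rewrite [LHS](ACl (1*4*9*5*8*2*6*10*3*7*11)).
Qed.

Lemma mulA : associative mul.
Proof.
have [ml mr] := mul_bilinear => x y z.
move: x; apply: (linear_eq_word (f := fun x => mul x _)
    (g := fun x => mul (mul x y) z)) => [||u wu].
- exact: ml.
- exact: (linear_compf (f := mul^~ z) (g := mul^~ y) (ml z) (ml y)).
move: y; apply: (linear_eq_word (f := fun y => mul _ (mul y z))
    (g := fun y => mul (mul (wordM u) y) z)) => [||v wv].
- exact: (linear_compf (f := mul (wordM u)) (g := mul^~ z) (mr _) (ml z)).
- exact: (linear_compf (f := mul^~ z) (g := mul (wordM u)) (ml z) (mr _)).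
move: z; apply: (linear_eq_word (f := fun z => mul _ (mul _ z))) => [||w ww].
- exact: (linear_compf (f := mul (wordM u)) (g := mul (wordM v)) (mr _) (mr _)).
- exact: mr.
exact: mulA_wordM.
Qed.

Lemma mul_is_algebra : is_algebra (wordM [::]) mul.
Proof. by split; [exact: mul_bilinear|exact: mulA|exact: mul1x|exact: mulx1]. Qed.

End ParQSymStructure.

(** * The coproduct and the character *)

HB.lock Definition qDelta (K : fieldType) : ParQSym K -> ParQSym K \ox ParQSym K :=
  @ParQSym_Delta K.

Lemma tensor_linear_eq (K : fieldType) (U V W : lmodType K) (f g : U \ox V -> W) :
  linear f -> linear g -> (forall u v, f (u \ox v) = g (u \ox v)) -> f =1 g.
Proof.
move=> fl gl e x; have [s ->] := tensor_span x.
by rewrite /fsum !linear_morph_sum //; apply: eq_bigr => p _.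
Qed.

Lemma linear_scaler (K : fieldType) (V : lmodType K) (k : K) : linear (fun x : V => k *: x).
Proof. by move=> a x y; rewrite scalerDr !scalerA mulrC. Qed.

Lemma word_catP u v : word (u ++ v) -> word u /\ word v.
Proof. by move=> w; split=> a au; apply: w; rewrite mem_cat au ?orbT. Qed.

Lemma dsum_unitl (K : fieldType) (V : lmodType K) (F : seq diag -> V) u :
  dsum (fun v w => (v == [::])%:R *: F w) u = F u.
Proof.
case: u => [|a u] /=; rewrite scale1r //.
by rewrite (eq_dsum (G := fun _ _ => 0)) ?dsum0 ?addr0 // => v w _; rewrite scale0r.
Qed.

Lemma dsum_unitr (K : fieldType) (V : lmodType K) (F : seq diag -> V) u :
  dsum (fun v w => (w == [::])%:R *: F v) u = F u.
Proof. by elim: u F => [|a u IHu] F /=; rewrite ?scale1r // IHu scale0r add0r. Qed.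

Section Coalgebra.
Variable K : fieldType.
Notation H := (ParQSym K).
Notation wordM := (@wordM K).
Notation prepend := (@prepend K).
Notation mul := (@qmul K).
Notation Delta := (@qDelta K).
Notation eps := (@ParQSym_eps K).
Notation zeta := (@ParQSym_zeta K).
Implicit Types (V : lmodType K) (x y z : H) (u v w : seq diag).

Lemma Delta_linear : linear Delta.
Proof. rewrite qDelta.unlock; exact: lin_ext_linear. Qed.

Lemma Delta_wordM u : word u -> Delta (wordM u) = dsum (fun v w => wordM v \ox wordM w) u.
Proof.
move=> wu; rewrite wordME qDelta.unlock /ParQSym_Delta lin_extE sum_splittings //.
by rewrite dsum_split_seq; apply: eq_dsum => v w _; rewrite !wordME.
Qed.

(** Sweedler notation on words: identities involving the coproduct become identities between sums
    over deconcatenations. *)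
Lemma tlift_Delta V (f : H -> H -> V) u : word u -> bilinear f ->
  tlift f (Delta (wordM u)) = dsum (fun v w => f (wordM v) (wordM w)) u.
Proof.
move=> wu fb; rewrite Delta_wordM // (dsum_morph _ _ (linear_morphD (tlift_linear fb))).
by apply: eq_dsum => v w _; rewrite tliftE.
Qed.

Lemma Delta_coassoc x : tassoc (tmap Delta id (Delta x)) = tmap id Delta (Delta x).
Proof.
have [Dl il] := (Delta_linear, @linear_idfun K H).
have bl := bilinear_tmap Dl il; have br := bilinear_tmap il Dl.
move: x; apply: linear_eq_word => [||u wu].
- apply: linear_compf; first exact: linear_tassoc.
  by apply: linear_compf => //; apply: linear_tmap.
- by apply: linear_compf => //; apply: linear_tmap.
rewrite /tmap !tlift_Delta // (dsum_morph _ _ (linear_morphD (@linear_tassoc K H H H))).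
pose F v1 v2 w : H \ox (H \ox H) := wordM v1 \ox (wordM v2 \ox wordM w).
transitivity (dsum (fun v w => dsum (fun v1 v2 => F v1 v2 w) v) u).
  apply: eq_dsum => v w e; have [wv ww] : word v /\ word w by apply: word_catP; rewrite e.
  have lin : linear (fun t : H \ox H => tassoc (t \ox wordM w)).
    apply: linear_compf; first exact: linear_tassoc.
    exact: (tpure_bilinear _ _).1.
  rewrite Delta_wordM // (dsum_morph _ _ (linear_morphD lin)).
  by apply: eq_dsum => v1 v2 _; rewrite tassocE.
rewrite dsumA; apply: eq_dsum => v w e.
have [wv ww] : word v /\ word w by apply: word_catP; rewrite e.
by rewrite Delta_wordM // (dsum_morph _ _ (linear_morphD ((tpure_bilinear _ _).2 (wordM v)))).
Qed.

Lemma eps_linear : scalar eps.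
Proof. exact: (@lin_ext_linear K K^o). Qed.

Lemma eps_wordM u : word u -> eps (wordM u) = (u == [::])%:R.
Proof.
move=> wu; rewrite wordME /ParQSym_eps lin_extE; congr (_%:R); congr nat_of_bool.
by apply/eqP/eqP => [/(dtensor_seq_eq_empty wu)|->].
Qed.

Lemma Delta_counitl x : tlift (fun a b => eps a *: b) (Delta x) = x.
Proof.
have bl : bilinear (fun a b : H => eps a *: b).
  split=> [b|a]; first exact: (linear_scalef (f := eps) b eps_linear).
  exact: linear_scaler.
move: x; apply: linear_eq_word => [|//|u wu].
  exact: linear_compf (tlift_linear bl) Delta_linear.
rewrite tlift_Delta // -[RHS](dsum_unitl wordM); apply: eq_dsum => v w e.
by rewrite eps_wordM //; have [] : word v /\ word w by apply: word_catP; rewrite e.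
Qed.

Lemma Delta_counitr x : tlift (fun a b => eps b *: a) (Delta x) = x.
Proof.
have br : bilinear (fun a b : H => eps b *: a).
  split=> [b|a]; last exact: (linear_scalef (f := eps) a eps_linear).
  exact: linear_scaler.
move: x; apply: linear_eq_word => [|//|u wu].
  exact: linear_compf (tlift_linear br) Delta_linear.
rewrite tlift_Delta // -[RHS](dsum_unitr wordM); apply: eq_dsum => v w e.
by rewrite eps_wordM //; have [] : word v /\ word w by apply: word_catP; rewrite e.
Qed.

Lemma Delta_is_coalgebra : is_coalgebra Delta eps.
Proof.
split; [exact: Delta_linear|exact: eps_linear|exact: Delta_coassoc| |].
- exact: Delta_counitl.
- exact: Delta_counitr.
Qed.

Lemma Delta_prepend a x : letter a ->
  Delta (prepend a x) = wordM [::] \ox prepend a x + tmap (prepend a) id (Delta x).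
Proof.
have [pl il] := (@prepend_linear K a, @linear_idfun K H).
move=> la; move: x; apply: linear_eq_word => [||u wu].
- exact: linear_compf Delta_linear pl.
- apply: linear_addf; first exact: linear_compf ((tpure_bilinear _ _).2 _) pl.
  exact: linear_compf (linear_tmap pl il) Delta_linear.
have wau : word (a :: u) by apply/word_cons.
rewrite /tmap tlift_Delta //; last exact: bilinear_tmap.
rewrite !prepend_wordM Delta_wordM //=; congr (_ + _).
by apply: eq_dsum => v w _; rewrite prepend_wordM.
Qed.

(** * Compatibility of the product with the coproduct and the counit *)

Let mb := @mul_bilinear K.
Let tm := bilinear_tmul mb.

Lemma tmul1t t : tmul mul (wordM [::] \ox wordM [::]) t = t.
Proof.
move: t; apply: tensor_linear_eq => [|//|a b]; first exact: tm.2.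
by rewrite tmulE // !mul1x.
Qed.

Lemma tmult1 t : tmul mul t (wordM [::] \ox wordM [::]) = t.
Proof.
move: t; apply: (tensor_linear_eq (f := (tmul mul)^~ _)) => [|//|a b]; first exact: tm.1.
by rewrite tmulE // !mulx1.
Qed.

Local Notation tprepend a := (tmap (prepend a) (@id H)).

Let pl a := @prepend_linear K a.
Let tl a : linear (tprepend a) := linear_tmap (@prepend_linear K a) (@linear_idfun K H).

Lemma tprependE a x y : tprepend a (x \ox y) = prepend a x \ox y.
Proof. by rewrite tmapE //; apply: prepend_linear. Qed.

(** [tprepend] acts only on the first factor, where [wordM [::]] is the unit. *)
Lemma tmul1p b x t :
  tmul mul (wordM [::] \ox x) (tprepend b t) = tprepend b (tmul mul (wordM [::] \ox x) t).
Proof.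
move: t; apply: tensor_linear_eq => [||y z].
- exact: (linear_compf (g := tprepend b) (tm.2 _) (tl b)).
- exact: (linear_compf (f := tprepend b) (tl b) (tm.2 _)).
by rewrite tmulE // !tprependE tmulE // !mul1x.
Qed.

Lemma tmulp1 a x s :
  tmul mul (tprepend a s) (wordM [::] \ox x) = tprepend a (tmul mul s (wordM [::] \ox x)).
Proof.
move: s; apply: tensor_linear_eq => [||y z].
- exact: (linear_compf (f := (tmul mul)^~ _) (tm.1 _) (tl a)).
- exact: (linear_compf (f := tprepend a) (tl a) (tm.1 _)).
by rewrite tmulE // !tprependE tmulE // !mulx1.
Qed.

(** On pure tensors this is [mul_prepend] in the first factor, with the same product in the second
    factor of all three terms. *)
Lemma tmul_tprepend a b s t : letter a -> letter b ->
  tmul mul (tprepend a s) (tprepend b t) =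
  tprepend a (tmul mul s (tprepend b t)) + tprepend b (tmul mul (tprepend a s) t) +
  tprepend (dbullet a b) (tmul mul s t).
Proof.
move=> la lb; move: s; apply: tensor_linear_eq => [||x x'].
- exact: (linear_compf (f := (tmul mul)^~ _) (tm.1 _) (tl a)).
- apply: linear_addf; [apply: linear_addf|].
  + exact: (linear_compf (f := tprepend a) (tl a) (tm.1 _)).
  + apply: (linear_compf (f := tprepend b) (tl b)).
    exact: (linear_compf (f := (tmul mul)^~ _) (tm.1 _) (tl a)).
  + exact: (linear_compf (f := tprepend _) (tl _) (tm.1 _)).
move: t; apply: tensor_linear_eq => [||y y'].
- exact: (linear_compf (g := tprepend b) (tm.2 _) (tl b)).
- apply: linear_addf; [apply: linear_addf|].
  + apply: (linear_compf (f := tprepend a) (tl a)).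
    exact: (linear_compf (g := tprepend b) (tm.2 _) (tl b)).
  + exact: (linear_compf (f := tprepend b) (tl b) (tm.2 _)).
  + exact: (linear_compf (f := tprepend _) (tl _) (tm.2 _)).
rewrite !tprependE !tmulE // !tprependE mul_prepend //.
by rewrite !(linear_morphD ((tpure_bilinear _ _).1 _)).
Qed.

Lemma DeltaM_wordM u v : word u -> word v ->
  Delta (mul (wordM u) (wordM v)) = tmul mul (Delta (wordM u)) (Delta (wordM v)).
Proof.
have Delta1 : Delta (wordM [::]) = wordM [::] \ox wordM [::] by rewrite Delta_wordM.
have [n] := ubnP (size u + size v)%N.
elim: n u v => // n IHn [|a u] [|b v] le_n;
  rewrite ?mul1x ?mulx1 ?Delta1 ?tmul1t ?tmult1 //.
move=> wau wbv; have /word_cons[la wu] := wau; have /word_cons[lb wv] := wbv.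
have lab := letter_bullet la lb.
rewrite /= in le_n; rewrite -!prepend_wordM.
set x := wordM u; set y := wordM v.
have A1 : Delta (mul x (prepend b y)) = tmul mul (Delta x) (Delta (prepend b y)).
  by rewrite !prepend_wordM; apply: IHn => //=; lia.
have A2 : Delta (mul (prepend a x) y) = tmul mul (Delta (prepend a x)) (Delta y).
  by rewrite !prepend_wordM; apply: IHn => //=; lia.
have A3 : Delta (mul x y) = tmul mul (Delta x) (Delta y) by apply: IHn => //=; lia.
rewrite mul_prepend // !(linear_morphD Delta_linear) !Delta_prepend // A1 A2 A3.
rewrite !Delta_prepend //.
have tmDl t := linear_morphD (tm.1 t); have tmDr s := linear_morphD (tm.2 s).
have tlD c := linear_morphD (tl c).
(* Each side has eight terms. On the right the two mixed products give one term each, and the other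
   two give three each by the product formula. *)
rewrite !(tmDl, tmDr) tmulE // mul1x tmul1p tmulp1 tmul_tprepend // !tlD mul_prepend //.
rewrite !(linear_morphD ((tpure_bilinear _ _).2 _)) !addrA.
by rewrite [LHS](ACl (1*4*7*5*2*3*6*8)).
Qed.

Lemma DeltaM x y : Delta (mul x y) = tmul mul (Delta x) (Delta y).
Proof.
move: x; apply: linear_eq_word => [||u wu].
- exact: (linear_compf (g := mul^~ y) Delta_linear (mb.1 y)).
- exact: (linear_compf (f := (tmul mul)^~ _) (tm.1 _) Delta_linear).
move: y; apply: linear_eq_word => [||v wv]; last exact: DeltaM_wordM.
- exact: (linear_compf (f := Delta) Delta_linear (mb.2 _)).
- exact: (linear_compf (f := tmul mul _) (tm.2 _) Delta_linear).
Qed.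

Lemma eps_prepend a x : letter a -> eps (prepend a x) = 0.
Proof.
move=> la; move: x; apply: (linear_eq_word (V := K^o) (f := fun x => eps _)) => [||u wu].
- exact: (linear_compf (f := eps : H -> K^o) eps_linear (pl a)).
- by move=> c x y; rewrite scaler0 addr0.
by rewrite prepend_wordM eps_wordM //; apply/word_cons.
Qed.

Lemma epsM x y : eps (mul x y) = eps x * eps y.
Proof.
move: x; apply: (linear_eq_word (V := K^o) (f := fun x => eps (mul x y))
  (g := fun x => eps x * eps y)) => [||u wu].
- exact: (linear_compf (f := eps : H -> K^o) eps_linear (mb.1 y)).
- by move=> c x x'; rewrite eps_linear mulrDl -mulrA.
move: y; apply: (linear_eq_word (V := K^o) (f := fun y => eps (mul _ y))
  (g := fun y => eps _ * eps y)) => [||v wv].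
- exact: (linear_compf (f := eps : H -> K^o) eps_linear (mb.2 _)).
- by move=> c y y'; rewrite eps_linear mulrDr mulrCA.
case: u wu v wv => [|a u] wu [|b v] wv;
  rewrite ?mul1x ?mulx1 ?(eps_wordM (u := [::])) ?mul1r ?mulr1 //.
have /word_cons[la _] := wu; have /word_cons[lb _] := wv.
have epsD := linear_morphD (eps_linear : linear (eps : H -> K^o)).
(* Every term of the product begins with a letter, so both sides vanish. *)
rewrite -!prepend_wordM mul_prepend // !epsD !eps_prepend //; last exact: letter_bullet.
by rewrite mul0r !addr0.
Qed.

Lemma ParQSym_is_bialgebra : is_bialgebra (wordM [::]) mul Delta eps.
Proof.
split; [exact: mul_is_algebra|exact: Delta_is_coalgebra|exact: DeltaM| |exact: epsM|].
- by rewrite Delta_wordM.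
- by rewrite eps_wordM.
Qed.

(** * The character *)

Lemma zeta_linear : scalar zeta.
Proof. exact: (@lin_ext_linear K K^o). Qed.

Lemma irreducible_empty : irreducible empty_diag.
Proof. by apply/irreducibleP => j /andP[j0]; rewrite ltnNge; case: j j0. Qed.

(** A word beginning with a letter is irreducible only if nothing follows that letter, and this is
    what [eps] detects on the rest. *)
Lemma zeta_prepend a x : letter a -> zeta (prepend a x) = eps x.
Proof.
move=> la; move: x; apply: (linear_eq_word (V := K^o) (f := fun x => zeta _)) => [||u wu].
- exact: (linear_compf (f := zeta : H -> K^o) zeta_linear (pl a)).
- exact: eps_linear.
rewrite prepend_wordM eps_wordM // wordME /ParQSym_zeta lin_extE.
congr (_%:R); congr nat_of_bool.
apply/asboolP/eqP => [irr|->]; last by rewrite /= tensor_empty; case: la.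
apply: (dtensor_seq_eq_empty wu); apply/eqP/negPn/negP => u0.
by apply: irr; exists a, (dtensor_seq u); case: la.
Qed.

Lemma zeta1 : zeta (wordM [::]) = 1.
Proof.
by rewrite wordME /ParQSym_zeta lin_extE asboolT //; apply: irreducible_empty.
Qed.

Lemma zetaM x y : zeta (mul x y) = zeta x * zeta y.
Proof.
move: x; apply: (linear_eq_word (V := K^o) (f := fun x => zeta (mul x y))
  (g := fun x => zeta x * zeta y)) => [||u wu].
- exact: (linear_compf (f := zeta : H -> K^o) zeta_linear (mb.1 y)).
- by move=> c x x'; rewrite zeta_linear mulrDl -mulrA.
move: y; apply: (linear_eq_word (V := K^o) (f := fun y => zeta (mul _ y))
  (g := fun y => zeta _ * zeta y)) => [||v wv].
- exact: (linear_compf (f := zeta : H -> K^o) zeta_linear (mb.2 _)).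
- by move=> c y y'; rewrite zeta_linear mulrDr mulrCA.
case: u wu v wv => [|a u] wu [|b v] wv; rewrite ?mul1x ?mulx1 ?zeta1 ?mul1r ?mulr1 //.
have /word_cons[la _] := wu; have /word_cons[lb _] := wv; have lab := letter_bullet la lb.
have zetaD := linear_morphD (zeta_linear : linear (zeta : H -> K^o)).
(* The first two terms become [eps (x * B_b y)] and [eps (B_a x * y)], which vanish. The merged term
   alone gives [eps x * eps y]. *)
rewrite -!prepend_wordM mul_prepend // !zetaD !zeta_prepend // !epsM !eps_prepend //.
by rewrite mulr0 mul0r !add0r.
Qed.

Lemma zeta_is_character : is_character (wordM [::]) mul zeta.
Proof. by split; [exact: zeta_linear|exact: zetaM|exact: zeta1]. Qed.

End Coalgebra.

(** * The antipode *)

Section Antipode.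
Variable K : fieldType.
Notation H := (ParQSym K).
Notation wordM := (@wordM K).
Notation mul := (@qmul K).
Notation Delta := (@qDelta K).
Notation eps := (@ParQSym_eps K).
Implicit Types (x y z : H) (u v w : seq diag) (f g h : seq diag -> H).

Let mb := @mul_bilinear K.
Let mulDl y : {morph mul^~ y : x x' / x + x'} := linear_morphD (mb.1 y).
Let mulDr x : {morph mul x : y y' / y + y'} := linear_morphD (mb.2 x).

(** Convolution of linear endomorphisms, represented by their values on words, so that inverses can
    be defined by recursion on lists. *)
Definition conv f g u := dsum (fun v w => mul (f v) (g w)) u.

Definition conv1 u : H := (u == [::])%:R *: wordM [::].

Lemma eq_convl f g h : f =1 g -> conv f h =1 conv g h.
Proof. by move=> e u; apply: eq_dsum => v w _; rewrite e. Qed.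

Lemma eq_convr f g h : f =1 g -> conv h f =1 conv h g.
Proof. by move=> e u; apply: eq_dsum => v w _; rewrite e. Qed.

Lemma convA f g h : conv f (conv g h) =1 conv (conv f g) h.
Proof.
move=> u; transitivity
    (dsum (fun v w => dsum (fun w1 w2 => mul (mul (f v) (g w1)) (h w2)) w) u).
  apply: eq_dsum => v w _; rewrite (dsum_morph _ _ (mulDr (f v))).
  by apply: eq_dsum => w1 w2 _; rewrite mulA.
rewrite -dsumA; apply: eq_dsum => v w _.
by rewrite (dsum_morph _ _ (mulDl (h w))).
Qed.

Lemma conv1l f : conv conv1 f =1 f.
Proof.
move=> u; rewrite -[RHS]dsum_unitl; apply: eq_dsum => v w _.
by rewrite (linear_morphZ _ (mb.1 _)) mul1x.
Qed.

Lemma conv1r f : conv f conv1 =1 f.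
Proof.
move=> u; rewrite -[RHS]dsum_unitr; apply: eq_dsum => v w _.
by rewrite (linear_morphZ _ (mb.2 _)) mulx1.
Qed.

(* [conv_inv f] is forced by [conv f (conv_inv f) = conv1]; [conv_step f h u] is
   [conv h (conv_inv f) u], which makes the recursion structural. *)
Fixpoint conv_step f h u : H :=
  if u is a :: u' then
    mul (h [::]) (- conv_step f (f \o cons a) u') + conv_step f (h \o cons a) u'
  else h [::].

Definition conv_inv f u : H :=
  if u is a :: u' then - conv_step f (f \o cons a) u' else wordM [::].

Lemma conv_stepE f h u : conv_step f h u = conv h (conv_inv f) u.
Proof.
elim: u h => [|a u IHu] h; first by rewrite /conv /= mulx1.
by rewrite /= (IHu (h \o cons a)).
Qed.

Lemma conv_invr f : f [::] = wordM [::] -> conv f (conv_inv f) =1 conv1.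
Proof.
move=> f1 [|a u]; rewrite /conv /conv1 /= f1 mul1x ?scale1r //.
by rewrite conv_stepE scale0r addNr.
Qed.

(** As in a monoid where right inverses exist: the right inverse [g] of [f] has a right inverse of
    its own, which associativity identifies with [f]. So [f] is a right inverse of [g]. *)
Lemma conv_invl f : f [::] = wordM [::] -> conv (conv_inv f) f =1 conv1.
Proof.
move=> f1 u; set g := conv_inv f.
have fE : f =1 conv_inv g.
  move=> v; rewrite -[LHS]conv1r -(eq_convr _ (conv_invr (f := g) erefl)) convA.
  by rewrite (eq_convl _ (conv_invr f1)) conv1l.
by rewrite (eq_convr _ fE) conv_invr.
Qed.

Definition antipode : H -> H := lin_ext (fun p => conv_inv wordM (factors p)).

Lemma antipode_wordM u : word u -> antipode (wordM u) = conv_inv wordM u.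
Proof. by move=> wu; rewrite {1}wordME /antipode lin_extE dtensor_seqK. Qed.

Lemma antipodeP : is_antipode (wordM [::]) mul Delta eps antipode.
Proof.
have Sl : linear antipode := @lin_ext_linear K H _.
have rl : linear (fun x => eps x *: wordM [::]).
  exact: (linear_scalef (f := eps : H -> K^o) _ (@eps_linear K)).
split=> // x.
  have bl : bilinear (fun a b => mul (antipode a) b).
    split=> [b|a]; last exact: mb.2.
    exact: (linear_compf (f := mul^~ b) (mb.1 b) Sl).
  move: x; apply: linear_eq_word => [|//|u wu].
    exact: linear_compf (tlift_linear bl) (@Delta_linear K).
  rewrite tlift_Delta // eps_wordM // -/(conv1 u) -(conv_invl (f := wordM) erefl).
  apply: eq_dsum => v w e; rewrite antipode_wordM //.
  by have [] : word v /\ word w by apply: word_catP; rewrite e.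
have br : bilinear (fun a b => mul a (antipode b)).
  split=> [b|a]; first exact: mb.1.
  exact: (linear_compf (f := mul a) (mb.2 a) Sl).
move: x; apply: linear_eq_word => [|//|u wu].
  exact: linear_compf (tlift_linear br) (@Delta_linear K).
rewrite tlift_Delta // eps_wordM // -/(conv1 u) -(conv_invr (f := wordM) erefl).
apply: eq_dsum => v w e; rewrite antipode_wordM //.
by have [] : word v /\ word w by apply: word_catP; rewrite e.
Qed.

End Antipode.

(** * The grading *)

Section Grading.
Variable K : fieldType.
Notation H := (ParQSym K).
Notation M := (@M K).
Notation wordM := (@wordM K).
Notation prepend := (@prepend K).
Notation mul := (@qmul K).
Notation Delta := (@qDelta K).
Notation eps := (@ParQSym_eps K).
Notation deg := (@ParQSym_deg K).
Notation wdeg := (fun u => dorder (dtensor_seq u)).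
Implicit Types (V : lmodType K) (x y z : H) (u v w : seq diag).

Lemma degP n x : deg n x <-> forall p, dorder p != n -> x@_p = 0.
Proof.
split=> [dx p np|dx p].
  by apply: mcoeff_outdom; apply/negP => /dx e; rewrite e eqxx in np.
by rewrite -mcoeff_neq0; apply: contra_neqP => np; apply/dx/eqP.
Qed.

Lemma deg_subspace n : is_subspace (deg n).
Proof.
split=> [|a x y]; first by apply/degP => p _; rewrite mcoeff0.
move=> /degP dx /degP dy; apply/degP => p np.
by rewrite mcoeffD mcoeffZ dx // dy // mulr0 addr0.
Qed.

Lemma deg_M p : deg (dorder p) (M p).
Proof. by apply/degP => q; rewrite mcoeffU; have [->|//] := eqVneq p q; rewrite eqxx. Qed.

Lemma deg_wordM u : deg (wdeg u) (wordM u).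
Proof. by rewrite wordME; apply: deg_M. Qed.

Lemma linear_deg V (f : H -> V) (P : V -> Prop) n x : linear f -> is_subspace P ->
  (forall p, dorder p = n -> P (f (M p))) -> deg n x -> P (f x).
Proof.
move=> fl sP PM dx; rewrite [x]ParQSym_expand linear_morph_sum // big_seq.
elim/big_ind: _ => [|y z Py Pz|p /dx ep]; [by case: sP|exact: is_subspaceD|].
by rewrite linear_morphZ //; apply: is_subspaceZ => //; apply: PM.
Qed.

Lemma deg_prepend a n x : deg n x -> deg (dorder a + n)%N (prepend a x).
Proof.
apply: linear_deg; [exact: prepend_linear|exact: deg_subspace|move=> p <-].
by rewrite prepend.unlock lin_extE -dorder_tensor; apply: deg_M.
Qed.

(** Follows the recursion for the product. All three terms have the same degree, because merging
    adds orders just as the tensor product does. *)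
Lemma deg_mul_wordM u v : word u -> word v ->
  deg (wdeg u + wdeg v)%N (mul (wordM u) (wordM v)).
Proof.
have [n] := ubnP (size u + size v)%N.
elim: n u v => // n IHn [|a u] [|b v] le_n.
- by move=> _ _; rewrite mul1x; apply: deg_wordM.
- by move=> _ _; rewrite mul1x; apply: deg_wordM.
- by move=> _ _; rewrite mulx1 addn0; apply: deg_wordM.
move=> wau wbv; have /word_cons[la wu] := wau; have /word_cons[lb wv] := wbv.
rewrite /= in le_n; rewrite -!prepend_wordM mul_prepend // !prepend_wordM /= !dorder_tensor.
apply: (is_subspaceD (deg_subspace _)); first apply: (is_subspaceD (deg_subspace _)).
- rewrite -addnA; apply: deg_prepend; rewrite -dorder_tensor.
  by apply: (IHn u (b :: v)) => //; rewrite /=; lia.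
- rewrite addnCA; apply: deg_prepend; rewrite -dorder_tensor.
  by apply: (IHn (a :: u) v) => //; rewrite /=; lia.
- rewrite addnACA -dorder_bullet; apply: deg_prepend.
  by apply: IHn => //; lia.
Qed.

Lemma deg_mul i j x y : deg i x -> deg j y -> deg (i + j)%N (mul x y).
Proof.
have [ml mr] := @mul_bilinear K; move=> dx dy; move: dx.
apply: (linear_deg (f := mul^~ y)); [exact: ml|exact: deg_subspace|move=> p ep].
move: dy; apply: linear_deg; [exact: mr|exact: deg_subspace|move=> q eq].
have := @deg_mul_wordM (factors p) (factors q).
rewrite !wordME !factorsK ep eq; apply; exact: word_factors.
Qed.

Lemma tensor_deg_subspace n : is_subspace (tensor_deg deg n).
Proof.
split; first by exists [::]; rewrite big_nil.
move=> a _ _ [s [-> sd]] [t [-> td]].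
exists ([seq (a *: p.1, p.2) | p <- s] ++ t); split.
  rewrite big_cat big_map scaler_sumr; congr (_ + _).
  by apply: eq_bigr => p _; rewrite (linear_morphZ _ ((tpure_bilinear _ _).1 p.2)).
move=> p; rewrite mem_cat => /orP[/mapP[q /sd[i [j [e di dj]]] ->]|/td//].
by exists i, j; split=> //=; apply: (is_subspaceZ _ (deg_subspace _)).
Qed.

Lemma deg_Delta n x : deg n x -> tensor_deg deg n (Delta x).
Proof.
apply: linear_deg; [exact: Delta_linear|exact: tensor_deg_subspace|move=> p ep].
have wf : word (factors p) by exact: word_factors.
rewrite qDelta.unlock /ParQSym_Delta lin_extE -{1}[p]factorsK sum_splittings //.
exists [seq (M rs.1, M rs.2) | rs <- split_seq (factors p)]; split; first by rewrite big_map.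
move=> _ /mapP[rs + ->]; rewrite mem_split_seq // factorsK => /eqP e.
by exists (dorder rs.1), (dorder rs.2); split; [rewrite -ep -e|exact: deg_M|exact: deg_M].
Qed.

Lemma deg_eps n x : (0 < n)%N -> deg n x -> eps x = 0.
Proof.
move=> n0; apply: (linear_deg (f := eps : H -> K^o) (P := eq^~ 0)).
- exact: eps_linear.
- by split=> // a y z -> ->; rewrite scaler0 addr0.
move=> p ep; rewrite /ParQSym_eps lin_extE -dorder0 ep.
by case: (n) n0.
Qed.

(** The offset [d] makes the induction go through: the recursion passes to [h \o cons a] or
    [f \o cons a], whose values have degree raised by the order of [a]. *)
Lemma deg_conv_step d (f h : seq diag -> H) u : word u ->
  (forall v, word v -> deg (wdeg v) (f v)) ->
  (forall v, word v -> deg (d + wdeg v)%N (h v)) -> deg (d + wdeg u)%N (conv_step f h u).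
Proof.
elim: u d f h => [|a u IHu] d f h wu df dh /=; first exact: dh.
have /word_cons[la wu'] := wu; rewrite dorder_tensor.
have cons_word v : word v -> word (a :: v) by move=> wv; apply/word_cons.
apply: (is_subspaceD (deg_subspace _)).
  apply: deg_mul; first by have := dh [::]; rewrite addn0; apply.
  apply: (is_subspaceN (deg_subspace _)); apply: IHu => // v wv.
  by have := df _ (cons_word _ wv); rewrite /= dorder_tensor.
rewrite addnA; apply: IHu => // v wv.
by have := dh _ (cons_word _ wv); rewrite /= dorder_tensor addnA.
Qed.

Lemma deg_conv_inv u : word u -> deg (wdeg u) (conv_inv wordM u).
Proof.
case: u => [|a u] wu; first exact: deg_wordM.
have /word_cons[la wu'] := wu; rewrite /= dorder_tensor.
apply: (is_subspaceN (deg_subspace _)).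
apply: deg_conv_step => // v _; first exact: deg_wordM.
by have := @deg_wordM (a :: v); rewrite /= dorder_tensor.
Qed.

Lemma deg_antipode n x : deg n x -> deg n (@antipode K x).
Proof.
apply: linear_deg; [exact: lin_ext_linear|exact: deg_subspace|move=> p <-].
rewrite /antipode lin_extE -{1}[p]factorsK; apply: deg_conv_inv; exact: word_factors.
Qed.

Lemma deg_direct_sum : is_direct_sum deg.
Proof.
split=> [n|x|N f df sf n nN]; first exact: deg_subspace.
  (* One more than the largest order in the support, so that the indices below [N] include every
     order that occurs. *)
  pose N := (\max_(p <- msupp x) dorder p).+1.
  exists N, (fun n => \sum_(p <- msupp x) if dorder p == n then x@_p *: M p else 0).
  split=> [n|].
    apply: (is_subspace_sum _ (deg_subspace n)) => p.
    case: eqP => [<-|_]; last by case: (deg_subspace n).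
    exact/(is_subspaceZ _ (deg_subspace _))/deg_M.
  rewrite {1}[x]ParQSym_expand exchange_big /= big_seq [RHS]big_seq.
  apply: eq_bigr => p px.
  have ltpN : (dorder p < N)%N by rewrite ltnS; apply: leq_bigmax_seq.
  by rewrite -big_mkcond (big_pred1 (Ordinal ltpN)).
apply/malgP => p; rewrite mcoeff0.
have [ep|np] := eqVneq (dorder p) n; last exact: (degP _ _).1 np.
(* At a diagram of order [n] only the summand [f n] can have a nonzero coefficient. *)
have /(congr1 (mcoeff p)) := sf.
rewrite raddf_sum mcoeff0 (bigD1 (Ordinal nN)) //= big1 ?addr0 //.
move=> m /eqP nm; apply: (degP _ _).1 (df _) _ _; rewrite ep.
by apply: contra_not_neq nm => e; apply: val_inj.
Qed.

Lemma deg_connected : is_connected deg.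
Proof.
exists (wordM [::]).
  apply/eqP => /(congr1 (mcoeff empty_diag)).
  by rewrite wordME mcoeff0 mcoeffUU => /eqP; rewrite oner_eq0.
move=> x; split=> [dx|[a ->]]; last first.
  exact/(is_subspaceZ _ (deg_subspace _))/(@deg_wordM [::]).
exists x@_empty_diag; apply/malgP => p; rewrite mcoeffZ wordME mcoeffU.
have [<-|np] := eqVneq empty_diag p; first by rewrite mulr1.
by rewrite mulr0; apply: (degP _ _).1 dx _ _; rewrite dorder0 eq_sym.
Qed.

End Grading.

Theorem proposition3p3 (K : fieldType) :
  is_combinatorial_hopf_algebra
    (@ParQSym_deg K) (M K empty_diag) (@ParQSym_mul K)
    (@ParQSym_Delta K) (@ParQSym_eps K) (@ParQSym_zeta K).
Proof.
have mulE : @ParQSym_mul K = @qmul K by rewrite qmul.unlock.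
have DeltaE : @ParQSym_Delta K = @qDelta K by rewrite qDelta.unlock.
rewrite -[M K _](wordME K [::]) mulE DeltaE.
split; [split|exact: deg_connected|exact: zeta_is_character].
- exact: ParQSym_is_bialgebra.
- exact: deg_direct_sum.
- exact: (@deg_wordM K [::]).
- exact: deg_mul.
- exact: deg_Delta.
- exact: deg_eps.
- by exists (@antipode K); split; [exact: antipodeP|exact: deg_antipode].
Qed.
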